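(* $\mathbf{S}(\pi)$ is a finite-dimensional semisimple $\mathbb{Q}(v)$-algebra.
   Context: Root data. Let $(a_{ij})_{1\le i,j\le n}$ be a Cartan matrix of finite type (not assumed indecomposable): integers with $a_{ii}=2$, $a_{ij}\le 0$ for $i\ne j$, and there are $d_i\in\{1,2,3\}$ with $(d_ia_{ij})$ symmetric and positive definite. Let $\mathfrak{g}$ be the corresponding semisimple Lie algebra over $\mathbb{Q}$, $\mathfrak{h}$ its Cartan subalgebra, $\alpha_i\in\mathfrak{h}^*$ the simple roots, $\alpha_i^\vee\in\mathfrak{h}$ the simple coroots, $\langle\alpha_i^\vee,\alpha_j\rangle=a_{ij}$, $W$ the Weyl group. Let $X=\{\lambda\in\mathfrak{h}^*\mid\langle\alpha_i^\vee,\lambda\rangle\in\mathbb{Z}\ \forall i\}$, $X^+=\{\lambda\in X\mid\langle\alpha_i^\vee,\lambda\rangle\ge0\ \forall i\}$, and write $\lambda\le\mu$ if $\mu-\lambda\in\sum_i\mathbb{N}\alpha_i$. Let $\pi\subset X^+$ be a finite saturated set, i.e. $\mu\in\pi$, $\lambda\in X^+$, $\lambda\le\mu$ imply $\lambda\in\pi$. Let $W\pi=\{w\mu\mid w\in W,\mu\in\pi\}$. Quantum notation. $v$ is an indeterminate, $v_i=v^{d_i}$, $[a]_i=(v_i^a-v_i^{-a})/(v_i-v_i^{-1})$, $\begin{bmatrix}a\\t\end{bmatrix}_i=\prod_{s=0}^{t-1}(v_i^{a-s}-v_i^{-a+s})/\prod_{s=1}^t(v_i^s-v_i^{-s})$ for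 $a\in\mathbb{Z}$, $t\in\mathbb{N}$. The algebra $\mathbf{S}(\pi)$. It is the associative unital $\mathbb{Q}(v)$-algebra with generators $E_i,F_i$ ($1\le i\le n$), $1_\lambda$ ($\lambda\in W\pi$) and relations: $1_\lambda1_\mu=\delta_{\lambda\mu}1_\lambda$, $\sum_{\lambda\in W\pi}1_\lambda=1$; $E_iF_j-F_jE_i=\delta_{ij}\sum_{\lambda\in W\pi}[\langle\alpha_i^\vee,\lambda\rangle]_i1_\lambda$; $E_i1_\lambda=1_{\lambda+\alpha_i}E_i$ if $\lambda+\alpha_i\in W\pi$ and $E_i1_\lambda=0$ otherwise; $F_i1_\lambda=1_{\lambda-\alpha_i}F_i$ if $\lambda-\alpha_i\in W\pi$ and $F_i1_\lambda=0$ otherwise; $1_\lambda E_i=E_i1_{\lambda-\alpha_i}$ if $\lambda-\alpha_i\in W\pi$ and $1_\lambda E_i=0$ otherwise; $1_\lambda F_i=F_i1_{\lambda+\alpha_i}$ if $\lambda+\alpha_i\in W\pi$ and $1_\lambda F_i=0$ otherwise; and for $i\ne j$ the quantum Serre relations $\sum_{s=0}^{1-a_{ij}}(-1)^s\begin{bmatrix}1-a_{ij}\\ s\end{bmatrix}_iE_i^{1-a_{ij}-s}E_jE_i^s=0$ and the same with $F$ in place of $E$. *)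

(* Defs.v *)
From HB Require Import structures.
From mathcomp Require Import all_boot all_order all_algebra.
From mathcomp Require Import generic_quotient ring_quotient.
From mathcomp Require Import finmap boolp classical_sets functions cardinality fsbigop.
From mathcomp.multinomials Require Import monalg.

Set Implicit Arguments.
Unset Strict Implicit.
Unset Printing Implicit Defensive.

Import Order.TTheory GRing.Theory Num.Theory.

Local Open Scope classical_set_scope.
Local Open Scope ring_scope.
Local Open Scope quotient_scope.

(* The structures used here allow the zero ring, since S(pi) = 0 when pi is   *)
(* empty.                                                                     *)

Definition finite_dimensional (K : fieldType) (V : lmodType K) : Prop :=
  exists m : nat, inhabited (Vector.axiom m V).

(* R^o is R as a left module over itself, so its submodules are left ideals. *)
Definition left_ideal (R : pzRingType) (L : {pred R^o}) : Prop :=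
  GRing.submod_closed L.

Definition simple_left_ideal (R : pzRingType) (L : {pred R^o}) : Prop :=
  [/\ left_ideal L,
      exists2 x, x \in L & x != 0 &
      forall L' : {pred R^o}, left_ideal L' -> {subset L' <= L} ->
        (exists2 x, x \in L' & x != 0) -> {subset L <= L'}].

(* The regular left module is a finite direct sum of simple submodules. *)
Definition semisimple_ring (R : pzRingType) : Prop :=
  exists (m : nat) (L : 'I_m -> {pred R^o}),
    (forall i, simple_left_ideal (L i)) /\
    (forall x : R^o, exists! u : {ffun 'I_m -> R^o},
       (forall i, u i \in L i) /\ x = \sum_i u i).

Section FreeAlgebra.
Variables (K : comNzRingType) (I : choiceType).

Definition freealg : Type := {malg K[{fmonom I}]}.

HB.instance Definition _ := GRing.Lalgebra.on freealg.

Lemma freealg_scalerAr (k : K) (x y : freealg) : k *: (x * y) = x * (k *: y).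
Proof.
apply/malgP => m; rewrite mcoeffZ mcoeffMl.
have le : (msupp (k *: y) `<=` msupp y)%fset.
  apply/fsubsetP => z; rewrite -!mcoeff_neq0 mcoeffZ.
  by apply: contra_neq => ->; rewrite mulr0.
rewrite (mcoeffMlw _ (fsubset_refl (msupp x)) le) mulr_sumr.
apply: eq_bigr => a _; rewrite mulr_sumr; apply: eq_bigr => b _.
by rewrite mcoeffZ mulrnAr mulrCA.
Qed.

HB.instance Definition _ := GRing.Lalgebra_isAlgebra.Build K freealg freealg_scalerAr.

Definition freegen (i : I) : freealg := << fmu i >>.

End FreeAlgebra.

Section Presentation.
Variables (K : comNzRingType) (F : algType K) (rel : F -> F -> Prop).

Inductive relideal : F -> Prop :=
| RelidealRel x y of rel x y : relideal (x - y)
| Relideal0 : relideal 0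
| RelidealB x y of relideal x & relideal y : relideal (x - y)
| RelidealM a x b of relideal x : relideal (a * x * b).

Definition relideal_pred : {pred F} := fun x => `[< relideal x >].

Lemma relidealP x : reflect (relideal x) (x \in relideal_pred).
Proof. exact: asboolP. Qed.

Lemma relideal_zmod : zmod_closed relideal_pred.
Proof.
split; first exact/relidealP/Relideal0.
by move=> x y /relidealP hx /relidealP hy; apply/relidealP; apply: RelidealB.
Qed.

HB.instance Definition _ :=
  GRing.isZmodClosed.Build F relideal_pred relideal_zmod.

Lemma relidealMl a x : x \in relideal_pred -> a * x \in relideal_pred.
Proof.
by move=> /relidealP hx; apply/relidealP; rewrite -[a * x]mulr1; apply: RelidealM.
Qed.

Lemma relidealMr x a : x \in relideal_pred -> x * a \in relideal_pred.
Proof.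
by move=> /relidealP hx; apply/relidealP; rewrite -[x]mul1r; apply: RelidealM.
Qed.

(* The K-algebra presented by F modulo the relations x = y for rel x y. *)
Definition presalg : Type := Quotient.quot relideal_pred.

HB.instance Definition _ := GRing.Zmodule.on presalg.
HB.instance Definition _ := EqQuotient.on presalg.

Definition presalg_pi (x : F) : presalg := \pi_presalg x.

Lemma presalg_eqP x y : reflect (relideal (x - y)) (presalg_pi x == presalg_pi y).
Proof. by rewrite /presalg_pi piE; exact: relidealP. Qed.

Lemma presalg_piB : {morph presalg_pi : x y / x - y}.
Proof. by move=> x y; rewrite /presalg_pi !piE. Qed.

Lemma presalg_piD : {morph presalg_pi : x y / x + y}.
Proof. by move=> x y; rewrite /presalg_pi !piE. Qed.

Lemma presalg_piK (x : presalg) : presalg_pi (repr x) = x.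
Proof. exact: reprK. Qed.

Definition presalg_one : presalg := presalg_pi 1.
Definition presalg_mul (x y : presalg) : presalg := presalg_pi (repr x * repr y).
Definition presalg_scale (k : K) (x : presalg) : presalg := presalg_pi (k *: repr x).

Lemma presalg_piM x y : presalg_pi (x * y) = presalg_mul (presalg_pi x) (presalg_pi y).
Proof.
apply/eqP/presalg_eqP; apply/relidealP; set x' := repr _; set y' := repr _.
have ex : x - x' \in relideal_pred.
  by apply/relidealP; apply/presalg_eqP; rewrite presalg_piK.
have ey : y - y' \in relideal_pred.
  by apply/relidealP; apply/presalg_eqP; rewrite presalg_piK.
have -> : x * y - x' * y' = (x - x') * y + x' * (y - y').
  by rewrite mulrBl mulrBr addrA subrK.
by apply: rpredD; [exact: relidealMr | exact: relidealMl].
Qed.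

Lemma presalg_piZ k x : presalg_pi (k *: x) = presalg_scale k (presalg_pi x).
Proof.
apply/eqP/presalg_eqP; apply/relidealP; rewrite -scalerBr -mulr_algl relidealMl //.
by apply/relidealP; apply/presalg_eqP; rewrite presalg_piK.
Qed.

Lemma presalg_mulA : associative presalg_mul.
Proof.
move=> x y z; rewrite -[x]presalg_piK -[y]presalg_piK -[z]presalg_piK.
by rewrite -!presalg_piM mulrA.
Qed.

Lemma presalg_mul1x : left_id presalg_one presalg_mul.
Proof. by move=> x; rewrite -[x]presalg_piK -presalg_piM mul1r. Qed.

Lemma presalg_mulx1 : right_id presalg_one presalg_mul.
Proof. by move=> x; rewrite -[x]presalg_piK -presalg_piM mulr1. Qed.

Lemma presalg_mulDl : left_distributive presalg_mul +%R.
Proof.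
move=> x y z; rewrite -[x]presalg_piK -[y]presalg_piK -[z]presalg_piK.
by rewrite -presalg_piD -!presalg_piM -presalg_piD mulrDl.
Qed.

Lemma presalg_mulDr : right_distributive presalg_mul +%R.
Proof.
move=> x y z; rewrite -[x]presalg_piK -[y]presalg_piK -[z]presalg_piK.
by rewrite -presalg_piD -!presalg_piM -presalg_piD mulrDr.
Qed.

HB.instance Definition _ := GRing.Zmodule_isPzRing.Build presalg
  presalg_mulA presalg_mul1x presalg_mulx1 presalg_mulDl presalg_mulDr.

Lemma presalg_scaleA a b x :
  presalg_scale a (presalg_scale b x) = presalg_scale (a * b) x.
Proof. by rewrite -[x]presalg_piK -!presalg_piZ scalerA. Qed.

Lemma presalg_scale1 : left_id 1 presalg_scale.
Proof. by move=> x; rewrite -[x]presalg_piK -presalg_piZ scale1r. Qed.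

Lemma presalg_scaleDr : right_distributive presalg_scale +%R.
Proof.
move=> a x y; rewrite -[x]presalg_piK -[y]presalg_piK.
by rewrite -presalg_piD -!presalg_piZ -presalg_piD scalerDr.
Qed.

Lemma presalg_scaleDl x : {morph presalg_scale^~ x : a b / a + b}.
Proof.
by move=> a b; rewrite -[x]presalg_piK -!presalg_piZ -presalg_piD scalerDl.
Qed.

HB.instance Definition _ := GRing.Zmodule_isLmodule.Build K presalg
  presalg_scaleA presalg_scale1 presalg_scaleDr presalg_scaleDl.

(* The library's algType excludes the zero ring; these two identities are its *)
(* remaining axioms.                                                          *)
Lemma presalg_scalerAl (k : K) (x y : presalg) : k *: (x * y) = (k *: x) * y.
Proof.
rewrite -[x]presalg_piK -[y]presalg_piK.
change (presalg_scale k (presalg_mul (presalg_pi (repr x)) (presalg_pi (repr y))) =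
  presalg_mul (presalg_scale k (presalg_pi (repr x))) (presalg_pi (repr y))).
by rewrite -presalg_piM -!presalg_piZ -presalg_piM scalerAl.
Qed.

Lemma presalg_scalerAr (k : K) (x y : presalg) : k *: (x * y) = x * (k *: y).
Proof.
rewrite -[x]presalg_piK -[y]presalg_piK.
change (presalg_scale k (presalg_mul (presalg_pi (repr x)) (presalg_pi (repr y))) =
  presalg_mul (presalg_pi (repr x)) (presalg_scale k (presalg_pi (repr y)))).
by rewrite -presalg_piM -!presalg_piZ -presalg_piM scalerAr.
Qed.

End Presentation.

Section Weights.
Variables (n : nat) (A : 'M[int]_n).

Definition cartan_matrix_of_finite_type (d : 'I_n -> nat) : Prop :=
  [/\ forall i, A i i = 2,
      forall i j, i != j -> A i j <= 0,
      forall i, (1 <= d i <= 3)%N,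
      forall i j, (d i)%:Z * A i j = (d j)%:Z * A j i &
      forall x : 'I_n -> rat, (exists i, x i != 0) ->
        0 < \sum_i \sum_j x i * ((d i)%:Z * A i j)%:~R * x j].

(* The coroots form a basis of the Cartan subalgebra, so an element lambda of *)
(* X is determined by the integers <alpha_i^vee, lambda>, which are arbitrary: *)
(* lambda is encoded as the row vector of these integers.                     *)
Definition weight : Type := 'rV[int]_n.
HB.instance Definition _ := GRing.Zmodule.on weight.

Definition pairing (i : 'I_n) (lambda : weight) : int := lambda ord0 i.

Definition simple_root (j : 'I_n) : weight := \row_i A i j.

Definition dominant : set weight := [set lambda | forall i, 0 <= pairing i lambda].

Definition dominance_le (lambda mu : weight) : Prop :=
  exists c : 'I_n -> nat, mu - lambda = \sum_i simple_root i *+ c i.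

Definition saturated (pi : set weight) : Prop :=
  pi `<=` dominant /\
  forall lambda mu, pi mu -> dominant lambda -> dominance_le lambda mu -> pi lambda.

Definition simple_reflection (i : 'I_n) (lambda : weight) : weight :=
  lambda - simple_root i *~ pairing i lambda.

(* Every element of the Weyl group is a word in the simple reflections. *)
Definition weyl_action (w : seq 'I_n) (lambda : weight) : weight :=
  foldr simple_reflection lambda w.

Definition weyl_orbits (pi : set weight) : set weight :=
  [set lambda | exists w mu, pi mu /\ lambda = weyl_action w mu].

End Weights.

Definition Qv : fieldType := {fraction {poly rat}}.

Definition qvar : Qv := tofrac 'X.

Section QuantumNumbers.
Variable di : nat.
Let vi : Qv := qvar ^+ di.

Definition qint (a : int) : Qv := (vi ^ a - vi ^ (- a)) / (vi - vi^-1).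

Definition qbinom (a : int) (t : nat) : Qv :=
  (\prod_(0 <= s < t) (vi ^ (a - s%:Z) - vi ^ (- a + s%:Z))) /
  (\prod_(1 <= s < t.+1) (vi ^+ s - vi ^- s)).

End QuantumNumbers.

Section GeneralizedSchurAlgebra.
Variables (n : nat) (A : 'M[int]_n) (d : 'I_n -> nat) (pi : set (weight n)).

Let Wpi : set (weight n) := weyl_orbits A pi.
Let alpha := simple_root A.

Definition Sgen : choiceType := ('I_n + 'I_n + set_type Wpi)%type.

Definition Sfree : algType Qv := freealg Qv Sgen.

Definition genE (i : 'I_n) : Sfree := freegen Qv (inl (inl i) : Sgen).
Definition genF (i : 'I_n) : Sfree := freegen Qv (inl (inr i) : Sgen).

(* The generator 1_lambda for lambda in W pi, extended by 0 to all of X: this *)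
(* makes the "and 0 otherwise" cases of the relations implicit.               *)
Definition gen1 (lambda : weight n) : Sfree :=
  if insub lambda is Some l then freegen Qv (inr l : Sgen) else 0.

(* 1 - a_ij, which is nonnegative for i != j *)
Definition serre_exp (i j : 'I_n) : nat := `|1 - A i j|%N.

Definition serre (X : 'I_n -> Sfree) (i j : 'I_n) : Sfree :=
  \sum_(0 <= s < (serre_exp i j).+1)
    ((-1) ^+ s * qbinom (d i) (1 - A i j) s) *:
      (X i ^+ (serre_exp i j - s) * X j * X i ^+ s).

(* The sums over W pi are finite-support sums; W pi is finite when pi is. *)
Inductive Srel : Sfree -> Sfree -> Prop :=
| Srel_idem lambda mu of Wpi lambda & Wpi mu :
    Srel (gen1 lambda * gen1 mu) (gen1 lambda *+ (lambda == mu))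
| Srel_unit :
    Srel (\sum_(lambda \in Wpi) gen1 lambda) 1
| Srel_EF i j :
    Srel (genE i * genF j - genF j * genE i)
         ((\sum_(lambda \in Wpi) qint (d i) (pairing i lambda) *: gen1 lambda)
            *+ (i == j))
| Srel_E1 i lambda of Wpi lambda :
    Srel (genE i * gen1 lambda) (gen1 (lambda + alpha i) * genE i)
| Srel_F1 i lambda of Wpi lambda :
    Srel (genF i * gen1 lambda) (gen1 (lambda - alpha i) * genF i)
| Srel_1E i lambda of Wpi lambda :
    Srel (gen1 lambda * genE i) (genE i * gen1 (lambda - alpha i))
| Srel_1F i lambda of Wpi lambda :
    Srel (gen1 lambda * genF i) (genF i * gen1 (lambda + alpha i))
| Srel_serreE i j of i != j : Srel (serre genE i j) 0
| Srel_serreF i j of i != j : Srel (serre genF i j) 0.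

Definition Salg : Type := presalg Srel.
HB.instance Definition _ := GRing.PzRing.on Salg.
HB.instance Definition _ := GRing.Lmodule.on Salg.

End GeneralizedSchurAlgebra.

(* Main.v *)
Require Import Defs.
From HB Require Import structures.
From mathcomp Require Import all_boot all_order all_algebra.
From mathcomp Require Import ring lra zify.
From mathcomp Require Import finmap boolp classical_sets cardinality.
From mathcomp Require Import fsbigop.
From mathcomp.multinomials Require Import monalg.

Set Implicit Arguments.
Unset Strict Implicit.
Unset Printing Implicit Defensive.
Import Order.TTheory GRing.Theory Num.Theory.
Local Open Scope ring_scope.

(** Why the theorem is true.

    Sorting letters shows that S(pi) is spanned by products
    F_{i_1}..F_{i_a} 1_mu E_{j_1}..E_{j_b}.  Each letter moves weights by a
    simple root, hence changes their height by one, and W pi is finite (the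
    W-invariant positive definite form bounds its elements), so long words
    vanish and S(pi) has finite dimension.

    For semisimplicity, 1 is written as a sum of elements that generate simple
    left ideals.  Let z be a nonzero central idempotent, lambda a weight of
    maximal height with 1_lambda z <> 0, and e = 1_lambda z.  Then E_i e = 0 and
    e F_i = 0, and the spanning set gives e S e = K e.  Multiplication pairs
    e S with S e, with values in K e.  If this pairing is nondegenerate, then
    dual families (p_j) of e S and (q_j) of S e produce the central idempotent
    eps = sum_j q_j p_j, each nonzero q_j p_j generates a simple left ideal, and
    1_lambda (z - eps) = 0.  Iterating from z = 1 exhausts the weights
    ([central_idempotent_in_socle]).

    A radical of the pairing would contain a vector x, killed by all E_i and of
    some weight mu <> lambda, in the finite dimensional module spanned by the
    F-words applied to e.  The main step is that there is none
    ([highest_weight_of_maximal]).  Over the local ring of Q(v) at v = 1 the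
    F-words span a free lattice; reducing it modulo v - 1 turns E_i, F_i into
    rational matrices with [E_i, F_j] = delta_ij H_i, H_i diagonal, and turns x
    into a maximal vector of weight mu.  So it is enough to treat such matrices
    ([maximal_vector_weight]), which is done with a Casimir operator.

    Let n+ and n- be the spaces of iterated commutators of the E_i and of the
    F_i, and h the span of the H_i.  The trace form (x, y) |-> tr(x y) pairs n+
    with n- nondegenerately: its radical in n+ is stable under all ad E_i and
    ad F_i, so ad H_i = [ad E_i, ad F_i] has trace 0 on it, although rho^vee
    acts on n+ with positive eigenvalues.  Hence dual bases of n- + h + n+ give
    an operator that commutes with the E_i and F_i, which is thus scalar on a
    highest weight module.  On a maximal vector of weight nu it equals
    (nu, nu + 2 rho), with 2 rho = sum_j [p_j, q_j] characterized by
    (2 rho, H_i) = 2.  For mu = lambda - sum_i c_i alpha_i the two values differ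
    by (lambda - mu, lambda + mu + 2 rho), which is positive because lambda and
    mu are dominant. *)

(** * Subspaces and dual families *)

(** A predicate rather than a subspace type, so that the same lemmas serve
    matrices and the algebra S(pi). *)
Definition subspace (K : fieldType) (V : lmodType K) (P : V -> Prop) : Prop :=
  P 0 /\ forall a x y, P x -> P y -> P (a *: x + y).

Definition spans (K : fieldType) (V : lmodType K) (P : V -> Prop) k
    (g : 'I_k -> V) : Prop :=
  (forall i, P (g i)) /\
  (forall x, P x -> exists c : 'I_k -> K, x = \sum_i c i *: g i).

Section Subspace.
Variables (K : fieldType) (V : lmodType K) (P : V -> Prop).
Hypothesis subP : subspace P.

Lemma subspace0 : P 0. Proof. by case: subP. Qed.

Lemma subspaceD x y : P x -> P y -> P (x + y).
Proof. by move=> px py; rewrite -[x]scale1r; apply: subP.2. Qed.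

Lemma subspaceZ a x : P x -> P (a *: x).
Proof. by move=> px; rewrite -[_ *: _]addr0; apply: subP.2 => //; case: subP. Qed.

Lemma subspaceN x : P x -> P (- x).
Proof. by move=> px; rewrite -scaleN1r; apply: subspaceZ. Qed.

Lemma subspaceB x y : P x -> P y -> P (x - y).
Proof. by move=> px py; apply: subspaceD => //; apply: subspaceN. Qed.

Lemma subspace_sum (I : Type) (r : seq I) (Q : pred I) (f : I -> V) :
  (forall i, Q i -> P (f i)) -> P (\sum_(i <- r | Q i) f i).
Proof.
by move=> Pf; apply: big_ind => //; [exact: subspace0 | exact: subspaceD].
Qed.

End Subspace.

Lemma linear_forE (K : fieldType) (V W : lmodType K) (f : V -> W) :
  linear f -> [/\ f 0 = 0, forall x y, f (x + y) = f x + f y,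
    forall a x, f (a *: x) = a *: f x &
    forall (I : Type) (r : seq I) (P : pred I) (x : I -> V),
      f (\sum_(i <- r | P i) x i) = \sum_(i <- r | P i) f (x i)].
Proof.
move=> lf.
have fD x y : f (x + y) = f x + f y by rewrite -[x]scale1r lf !scale1r.
have f0 : f 0 = 0 by apply: (addrI (f 0)); rewrite -fD !addr0.
have fZ a x : f (a *: x) = a *: f x by rewrite -[_ *: x]addr0 lf f0 addr0.
by split=> // I r P x; apply: (big_morph f fD f0).
Qed.

(** A free family inside the subspace of maximal length must span it. *)
Lemma subspace_spanned (K : fieldType) (V : vectType K) (P : V -> Prop) :
  subspace P -> exists k (g : 'I_k -> V), spans P g.
Proof.
move=> sP.
pose Q k := `[< exists s : seq V, [/\ size s = k, free s & forall x, x \in s -> P x] >].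
have Q0 : Q 0%N by apply/asboolP; exists [::]; split=> //; rewrite nil_free.
have Qmax k : Q k -> (k <= \dim {:V})%N.
  move=> /asboolP [s [<- fs _]].
  by rewrite -(eqP (fs : (\dim <<s>> == size s)%VS)) dimvS ?subvf.
have exQ : exists k, Q k by exists 0%N.
case: (ex_maxnP exQ Qmax) => k /asboolP [s [sk fs sP']] kmax.
exists (size s), (fun i => s`_i); split=> [i|x Px]; first by apply: sP'; rewrite mem_nth.
have: x \in <<s>>%VS.
  apply: contraT => xs; have: Q k.+1.
    apply/asboolP; exists (x :: s); split=> /=; [by rewrite sk|by rewrite free_cons xs|].
    by move=> y; rewrite inE => /orP [/eqP ->|/sP'].
  by move/kmax; rewrite ltnn.
move=> /(@coord_span _ _ _ (in_tuple s)) xE.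
by exists (fun i => coord (in_tuple s) i x).
Qed.

Section DualFamilies.
Variables (K : fieldType) (W : lmodType K) (beta : W -> W -> K).
Hypothesis beta_linl : forall z, linear (fun x => beta x z : K^o).
Hypothesis beta_linr : forall z, linear (fun x => beta z x : K^o).

Let betaDl z x y : beta (x + y) z = beta x z + beta y z.
Proof. by have [_ -> _ _] := linear_forE (beta_linl z). Qed.
Let betaZl z a x : beta (a *: x) z = a * beta x z.
Proof. by have [_ _ -> _] := linear_forE (beta_linl z). Qed.
Let beta_suml z (I : Type) (r : seq I) (P : pred I) (x : I -> W) :
  beta (\sum_(i <- r | P i) x i) z = \sum_(i <- r | P i) beta (x i) z.
Proof. by have [_ _ _ ->] := linear_forE (beta_linl z). Qed.
Let betaZr z a x : beta z (a *: x) = a * beta z x.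
Proof. by have [_ _ -> _] := linear_forE (beta_linr z). Qed.
Let beta_sumr z (I : Type) (r : seq I) (P : pred I) (x : I -> W) :
  beta z (\sum_(i <- r | P i) x i) = \sum_(i <- r | P i) beta z (x i).
Proof. by have [_ _ _ ->] := linear_forE (beta_linr z). Qed.

(** The reproducing formulas of dual bases, for families that may be linearly
    dependent. *)
Definition dual_families (P Q : W -> Prop) (I : finType) (p q : I -> W) : Prop :=
  [/\ forall i, P (p i), forall i, Q (q i),
      forall x, P x -> x = \sum_i beta x (q i) *: p i &
      forall y, Q y -> y = \sum_i beta (p i) y *: q i].

(** With G the Gram matrix of the spanning families and Z a generalized inverse,
    G Z G = G, the combinations of the first family with coefficients Z are dual
    to the second family modulo the radicals, which vanish. *)
Lemma exists_dual_families (P Q : W -> Prop) k (g : 'I_k -> W) l (h : 'I_l -> W) :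
  subspace P -> subspace Q -> spans P g -> spans Q h ->
  (forall x, P x -> (forall y, Q y -> beta x y = 0) -> x = 0) ->
  (forall y, Q y -> (forall x, P x -> beta x y = 0) -> y = 0) ->
  exists p : 'I_l -> W, dual_families P Q p h.
Proof.
move=> sP sQ [Pg gP] [Qh hQ] ndP ndQ.
pose G : 'M[K]_(k, l) := \matrix_(a, b) beta (g a) (h b).
(* G is rectangular and possibly singular; pinvmx only satisfies G Z G = G. *)
pose Z := pinvmx G.
have GZG : G *m Z *m G = G by rewrite mulmxKpV.
have GE a b : \sum_c \sum_d G a c * Z c d * G d b = G a b.
  rewrite -[in RHS]GZG [RHS]mxE exchange_big; apply: eq_bigr => d _.
  by rewrite [in RHS]mxE mulr_suml.
pose p b := \sum_a Z b a *: g a.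
have Pp b : P (p b) by apply: subspace_sum => // a _; apply: subspaceZ.
have betap b y : beta (p b) y = \sum_a Z b a * beta (g a) y.
  by rewrite /p beta_suml; apply: eq_bigr => a _; rewrite betaZl.
clearbody p.
exists p; split=> // [x Px|y Qy]; apply/eqP; rewrite -subr_eq0; apply/eqP.
  apply: ndP => [|y /hQ [e ->]].
    by apply: subspaceB => //; apply: subspace_sum => // b _; apply: subspaceZ.
  rewrite beta_sumr big1 // => b _; rewrite betaZr -scaleN1r betaDl betaZl mulN1r.
  rewrite [X in _ - X](_ : _ = beta x (h b)) ?subrr ?mulr0 //.
  have [c ->] := gP _ Px; rewrite !beta_suml.
  under eq_bigr do rewrite betaZl beta_suml mulr_suml.
  rewrite exchange_big /=; apply: eq_bigr => a _; rewrite betaZl.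
  under eq_bigr do rewrite betaZl -mulrA betap.
  rewrite -mulr_sumr; congr (_ * _).
  have := GE a b; rewrite mxE => <-; apply: eq_bigr => c' _.
  by rewrite mulr_sumr; apply: eq_bigr => d _; rewrite !mxE mulrA.
apply: ndQ => [|x /gP [e ->]].
  by apply: subspaceB => //; apply: subspace_sum => // b _; apply: subspaceZ.
rewrite beta_suml big1 // => a _; rewrite betaZl.
have [_ -> _ _] := linear_forE (beta_linr (g a)).
rewrite -scaleN1r betaZr mulN1r beta_sumr.
rewrite [X in _ - X](_ : _ = beta (g a) y) ?subrr ?mulr0 //.
have [c ->] := hQ _ Qy; rewrite beta_sumr.
under eq_bigr do rewrite betaZr beta_sumr mulr_suml.
rewrite exchange_big /=; apply: eq_bigr => b _; rewrite betaZr.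
under eq_bigr do rewrite betaZr -mulrA betap.
rewrite -mulr_sumr; congr (_ * _).
have := GE a b; rewrite mxE => <-; apply: eq_bigr => c' _.
rewrite mulr_suml; apply: eq_bigr => d _; rewrite !mxE.
by rewrite mulrC mulrA.
Qed.

(** The sum of beta (u p_b) q_b is the trace of u on P, and a trace does not see
    the order of a product. *)
Lemma dual_traceC (P Q : W -> Prop) (I : finType) (p q : I -> W) (f g : W -> W) :
  dual_families P Q p q -> linear f -> linear g ->
  (forall x, P x -> P (f x)) -> (forall x, P x -> P (g x)) ->
  \sum_b beta (f (g (p b))) (q b) = \sum_b beta (g (f (p b))) (q b).
Proof.
move=> [Pp Qq pE qE] lf lg Pf Pg.
have [_ _ fZ fS] := linear_forE lf; have [_ _ gZ gS] := linear_forE lg.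
have L u v : linear u -> (forall a x, u (a *: x) = a *: u x) ->
   (forall r (x : I -> W), u (\sum_(i <- r) x i) = \sum_(i <- r) u (x i)) ->
   (forall x, P x -> P (v x)) ->
   \sum_b beta (u (v (p b))) (q b) =
   \sum_b \sum_c beta (v (p b)) (q c) * beta (u (p c)) (q b).
  move=> _ uZ uS Pv; apply: eq_bigr => b _.
  rewrite {1}[v (p b)]pE ?uS; last exact: Pv.
  by rewrite beta_suml; apply: eq_bigr => c _; rewrite uZ betaZl.
rewrite (L f g) // (L g f) // exchange_big /=.
by apply: eq_bigr => b _; apply: eq_bigr => c _; rewrite mulrC.
Qed.

End DualFamilies.

Section Commutators.
Variables (R : fieldType) (N : nat).
Implicit Types x y z : 'M[R]_N.

(** * Commutators and the trace form *)

Definition commut x y : 'M[R]_N := x * y - y * x.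

Definition trform x y : R := \tr (x * y).

Lemma commut_linr z : linear (commut z).
Proof.
move=> a x y; rewrite /commut mulrDr mulrDl scalerBr opprD addrACA.
by rewrite -[(a *: x) * z]scalemxAl -[z * (a *: x)]scalemxAr.
Qed.

Lemma commutC x y : commut x y = - commut y x. Proof. by rewrite opprB. Qed.

Lemma commutDr z x y : commut z (x + y) = commut z x + commut z y.
Proof. by have [_ -> _ _] := linear_forE (commut_linr z). Qed.

Lemma commutZr z a x : commut z (a *: x) = a *: commut z x.
Proof. by have [_ _ -> _] := linear_forE (commut_linr z). Qed.

Lemma commut0r z : commut z 0 = 0.
Proof. by have [-> _ _ _] := linear_forE (commut_linr z). Qed.

Lemma commut0l z : commut 0 z = 0.
Proof. by rewrite commutC commut0r oppr0. Qed.

Lemma commut_sumr z (I : Type) (r : seq I) (P : pred I) (x : I -> 'M[R]_N) :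
  commut z (\sum_(i <- r | P i) x i) = \sum_(i <- r | P i) commut z (x i).
Proof. by have [_ _ _ ->] := linear_forE (commut_linr z). Qed.

Lemma commut_suml z (I : Type) (r : seq I) (P : pred I) (x : I -> 'M[R]_N) :
  commut (\sum_(i <- r | P i) x i) z = \sum_(i <- r | P i) commut (x i) z.
Proof.
by rewrite commutC commut_sumr -sumrN; apply: eq_bigr => i _; rewrite -commutC.
Qed.

Lemma commutDl z x y : commut (x + y) z = commut x z + commut y z.
Proof. by rewrite commutC commutDr opprD -!commutC. Qed.

Lemma commutZl z a x : commut (a *: x) z = a *: commut x z.
Proof. by rewrite commutC commutZr -scalerN -commutC. Qed.

Lemma commutNl z x : commut (- x) z = - commut x z.
Proof. by rewrite -scaleN1r commutZl scaleN1r. Qed.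

Lemma commutNr z x : commut z (- x) = - commut z x.
Proof. by rewrite -scaleN1r commutZr scaleN1r. Qed.

Lemma commutMr x y z : commut x (y * z) = commut x y * z + y * commut x z.
Proof. by rewrite /commut mulrBl mulrBr !mulrA addrA subrK. Qed.

Lemma jacobi x y z :
  commut x (commut y z) = commut (commut x y) z + commut y (commut x z).
Proof.
transitivity (commut x (y * z) - commut x (z * y)); first by rewrite commutDr commutNr.
by rewrite !commutMr opprD [- _ - _]addrC addrACA.
Qed.

Lemma trform_linl z : linear (fun x => trform x z : R^o).
Proof. by move=> a x y; rewrite /trform mulrDl -[(a *: x) * z]scalemxAl linearP. Qed.

Lemma trformC x y : trform x y = trform y x.
Proof. exact: mxtrace_mulC. Qed.

Lemma trform_linr z : linear (fun x => trform z x : R^o).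
Proof. by move=> a x y; rewrite !(trformC z) trform_linl. Qed.

Lemma trformDl z x y : trform (x + y) z = trform x z + trform y z.
Proof. by have [_ -> _ _] := linear_forE (trform_linl z). Qed.
Lemma trformZl z a x : trform (a *: x) z = a * trform x z.
Proof. by have [_ _ -> _] := linear_forE (trform_linl z). Qed.
Lemma trform_suml z (I : Type) (r : seq I) (P : pred I) (x : I -> 'M[R]_N) :
  trform (\sum_(i <- r | P i) x i) z = \sum_(i <- r | P i) trform (x i) z.
Proof. by have [_ _ _ ->] := linear_forE (trform_linl z). Qed.
Lemma trform0l z : trform 0 z = 0.
Proof. by have [-> _ _ _] := linear_forE (trform_linl z). Qed.
Lemma trformNl z x : trform (- x) z = - trform x z.
Proof. by rewrite -scaleN1r trformZl mulN1r. Qed.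
Lemma trformDr z x y : trform z (x + y) = trform z x + trform z y.
Proof. by rewrite !(trformC z) trformDl. Qed.
Lemma trformZr z a x : trform z (a *: x) = a * trform z x.
Proof. by rewrite !(trformC z) trformZl. Qed.
Lemma trform_sumr z (I : Type) (r : seq I) (P : pred I) (x : I -> 'M[R]_N) :
  trform z (\sum_(i <- r | P i) x i) = \sum_(i <- r | P i) trform z (x i).
Proof. by rewrite trformC trform_suml; apply: eq_bigr => i _; rewrite trformC. Qed.
Lemma trformNr z x : trform z (- x) = - trform z x.
Proof. by rewrite -scaleN1r trformZr mulN1r. Qed.

Lemma trform_inv x y z : trform (commut x y) z = trform x (commut y z).
Proof.
rewrite /trform /commut mulrBl mulrBr !linearB /= !mulrA; congr (_ - _).
by rewrite -[y * x * z]mulrA; exact: trformC.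
Qed.

End Commutators.

Section CartanTriple.
Variables (R : realFieldType) (n N : nat) (a : 'I_n -> 'I_n -> R) (r : 'I_n -> R).
Implicit Types (E F H : 'I_n -> 'M[R]_N).

(** * The positive and negative parts *)

(** Matrices acting on a finite dimensional weight module of the Lie algebra with
    Cartan matrix a, in a basis of weight vectors; N numbers this basis. *)
Record cartan_triple E F H : Prop := CartanTriple {
  ct_EF : forall i j, commut (E i) (F j) = H i *+ (i == j);
  ct_HE : forall i j, commut (H i) (E j) = a i j *: E j;
  ct_HF : forall i j, commut (H i) (F j) = - a i j *: F j;
  ct_diag : forall i b b', b != b' -> H i b b' = 0
}.

Hypothesis a_diag : forall i, a i i = 2.
Hypothesis rhov : forall j, \sum_i r i * a i j = 1.

(** The Chevalley involution: every statement on the positive part yields its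
    mirror image on the negative part. *)
Lemma cartan_triple_swap E F H :
  cartan_triple E F H -> cartan_triple F E (fun i => - H i).
Proof.
move=> ct; split=> [i j|i j|i j|i b b' bb'].
- rewrite commutC (ct_EF ct) eq_sym; case: eqP => [->|]; by rewrite ?mulNrn // mulr0n oppr0.
- by rewrite commutNl (ct_HF ct) scaleNr opprK.
- by rewrite commutNl (ct_HE ct) scaleNr.
- by rewrite mxE (ct_diag ct) //; exact: oppr0.
Qed.

(** The nilpotent part n+ of the Lie algebra generated by the E_i (and n- when
    applied to the F_i): iterated commutators associated to the right suffice. *)
Inductive nilpart E : 'M[R]_N -> Prop :=
| Nilpart_gen i : nilpart E (E i)
| Nilpart0 : nilpart E 0
| NilpartL c x y of nilpart E x & nilpart E y : nilpart E (c *: x + y)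
| Nilpart_commut i x of nilpart E x : nilpart E (commut (E i) x).

Lemma nilpart_subspace E : subspace (nilpart E).
Proof. by split=> [|c x y]; [exact: Nilpart0 | exact: NilpartL]. Qed.

(** The image of the Cartan subalgebra. *)
Definition torus H (x : 'M[R]_N) : Prop := exists c : 'I_n -> R, x = \sum_i c i *: H i.

Lemma torus_subspace H : subspace (torus H).
Proof.
split=> [|c x y [d ->] [e ->]].
  by exists (fun=> 0); rewrite big1 // => i _; rewrite scale0r.
exists (fun i => c * d i + e i); rewrite scaler_sumr -big_split /=.
by apply: eq_bigr => i _; rewrite scalerA scalerDl.
Qed.

Lemma torus_gen H i : torus H (H i).
Proof.
exists (fun j => (j == i)%:R); rewrite (bigD1 i) //= eqxx scale1r big1 ?addr0 // => j.
by move/negPf => ->; rewrite scale0r.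
Qed.

Lemma torus_opp H x : torus H x <-> torus (fun i => - H i) x.
Proof.
by split=> -[c ->]; exists (fun i => - c i); apply: eq_bigr => i _;
  rewrite scaleNr ?scalerN ?opprK.
Qed.

Section Triple.
Variables (E F H : 'I_n -> 'M[R]_N).
Hypothesis ct : cartan_triple E F H.

Let D := \sum_i r i *: H i.

Lemma torus_diag x b b' : torus H x -> b != b' -> x b b' = 0.
Proof.
by move=> [c ->] bb'; rewrite summxE big1 // => i _; rewrite mxE (ct_diag ct) // mulr0.
Qed.

Lemma torusMl x y b b' : torus H x -> (x * y) b b' = x b b * y b b'.
Proof.
move=> tx; rewrite mxE (bigD1 b) //= big1 ?addr0 // => k.
by rewrite eq_sym => kb; rewrite (torus_diag tx kb) mul0r.
Qed.

Lemma torusMr x y b b' : torus H x -> (y * x) b b' = y b b' * x b' b'.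
Proof.
move=> tx; rewrite mxE (bigD1 b') //= big1 ?addr0 // => k.
by move=> kb; rewrite (torus_diag tx kb) mulr0.
Qed.

Lemma commut_torus x y b b' :
  torus H x -> commut x y b b' = (x b b - x b' b') * y b b'.
Proof. by move=> tx; rewrite mxE [X in _ + X]mxE torusMl // torusMr //; ring. Qed.

Lemma torusD : torus H D. Proof. by exists r. Qed.

(** D represents rho^vee, the coweight on which every simple root takes the value 1. *)
Lemma commutDE j : commut D (E j) = E j.
Proof.
rewrite commut_suml -[RHS]scale1r -(rhov j) scaler_suml; apply: eq_bigr => i _.
by rewrite commutZl (ct_HE ct) scalerA.
Qed.

(** The diagonal of D grades the basis by height, and E_i raises this height by 1;
    elements of n+ are thus strictly triangular. *)
Lemma nilpart_raise x b b' : nilpart E x -> x b b' != 0 -> D b' b' < D b b.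
Proof.
have Ei i b1 b2 : E i b1 b2 != 0 -> D b2 b2 < D b1 b1.
  have /matrixP /(_ b1 b2) := commutDE i; rewrite commut_torus; last exact: torusD.
  move=> e nz; have : (D b1 b1 - D b2 b2 - 1) * E i b1 b2 = 0 by rewrite mulrBl e; ring.
  by move/eqP; rewrite mulf_eq0 (negPf nz) orbF => /eqP h; lra.
move=> nx; elim: nx b b' => {x} [i|| c x y _ IHx _ IHy | i x _ IHx] b b'.
- exact: Ei.
- by rewrite mxE eqxx.
- rewrite !mxE => nz; have [xz|/IHx //] := eqVneq (x b b') 0.
  by apply: IHy; move: nz; rewrite xz mulr0 add0r.
have P (u v : 'M[R]_N) : (forall b1 b2, u b1 b2 != 0 -> D b2 b2 < D b1 b1) ->
    (forall b1 b2, v b1 b2 != 0 -> D b2 b2 < D b1 b1) ->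
    (u * v) b b' != 0 -> D b' b' < D b b.
  move=> hu hv; apply: contraTT => nlt; rewrite negbK mxE big1 // => k _.
  apply/eqP; rewrite mulf_eq0; apply: contraNT nlt;
    rewrite negb_or => /andP [/hu h1 /hv h2].
  exact: lt_trans h2 h1.
rewrite mxE [X in _ + X]mxE => nz; have [z|/P] := eqVneq ((E i * x) b b') 0;
  last by apply=> //; apply: Ei.
by apply: (P x (E i) IHx (Ei i)) => //; move: nz; rewrite z add0r oppr_eq0.
Qed.

Lemma trform_nilpart x y : nilpart E x -> nilpart E y -> trform x y = 0.
Proof.
move=> nx ny; apply: big1 => b _; rewrite mxE big1 // => k _; apply/eqP.
apply: contraT; rewrite mulf_eq0 negb_or => /andP [/(nilpart_raise nx) h1].
by move=> /(nilpart_raise ny) /(lt_trans h1); rewrite ltxx.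
Qed.

Lemma trform_nilpart_torus x y : nilpart E x -> torus H y -> trform x y = 0.
Proof.
move=> nx ty; apply: big1 => b _; rewrite torusMr //.
have [->|/(nilpart_raise nx)] := eqVneq (x b b) 0; first by rewrite mul0r.
by rewrite ltxx.
Qed.

(** A trace of squares of real diagonal entries. *)
Lemma trform_torus_eq0 x : torus H x -> trform x x = 0 -> x = 0.
Proof.
move=> tx /eqP; rewrite psumr_eq0 => [/allP z|b _]; last first.
  by rewrite torusMl // -expr2 sqr_ge0.
apply/matrixP => b b'; rewrite mxE; have [<-|] := eqVneq b b'; last exact: torus_diag.
have /z := mem_index_enum b; rewrite torusMl // -expr2 sqrf_eq0.
by move/eqP.
Qed.

Lemma commutHE h i : torus H h -> exists c, commut h (E i) = c *: E i.
Proof.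
move=> [c ->]; exists (\sum_j c j * a j i); rewrite commut_suml scaler_suml.
by apply: eq_bigr => j _; rewrite commutZl (ct_HE ct) scalerA.
Qed.

Lemma nilpart_commutH h x : torus H h -> nilpart E x -> nilpart E (commut h x).
Proof.
move=> th; have sp := nilpart_subspace E.
elim=> {x} [i||c x y _ IHx _ IHy|i x nx IHx].
- by have [c ->] := commutHE i th; apply: subspaceZ => //; apply: Nilpart_gen.
- by rewrite commut0r; apply: Nilpart0.
- by rewrite commutDr commutZr; apply: NilpartL.
- rewrite jacobi; apply: subspaceD => //; last exact: Nilpart_commut.
  have [c ->] := commutHE i th; rewrite commutZl; apply: subspaceZ => //.
  exact: Nilpart_commut.
Qed.

(** Jacobi, by induction on the commutator: F_j can only meet E_j, where it
    produces an element of the torus. *)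
Lemma commutF_nilpart j x : nilpart E x ->
  exists y h, [/\ nilpart E y, torus H h & commut (F j) x = y + h].
Proof.
have sp := nilpart_subspace E; have st := torus_subspace H.
elim=> {x} [i||c x y _ [x1 [h1 [nx th1 e1]]] _ [y1 [h2 [ny th2 e2]]]|i x nx [y [h [ny
  th e]]]].
- exists 0, (- (H i *+ (i == j))); split; [exact: Nilpart0| |].
    apply: subspaceN => //; case: eqP => _; rewrite ?mulr1n ?mulr0n.
      exact: torus_gen.
    exact: subspace0.
  by rewrite add0r -(ct_EF ct) -commutC.
- by exists 0, 0; rewrite addr0 commut0r; split; [exact: Nilpart0|exact: subspace0|].
- exists (c *: x1 + y1), (c *: h1 + h2); split; [exact: NilpartL|exact: st.2|].
  by rewrite commutDr commutZr e1 e2 scalerDr addrACA.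
- exists (- (commut (H i) x *+ (i == j)) + (commut (E i) y - commut h (E i))), 0.
  split; [|exact: subspace0|]; last first.
    rewrite addr0 jacobi e commutDr [commut (E i) h]commutC; congr (_ + _).
    rewrite [commut (F j) _]commutC (ct_EF ct) commutNl.
    by case: eqP => _; rewrite ?mulr1n ?mulr0n ?commut0l.
  apply: subspaceD => //.
    apply: subspaceN => //; case: eqP => _; rewrite ?mulr1n ?mulr0n.
      exact/nilpart_commutH/nx/torus_gen.
    exact: Nilpart0.
  apply: subspaceB => //; first exact: Nilpart_commut.
  by apply: nilpart_commutH => //; apply: Nilpart_gen.
Qed.

Definition nilpart_rad (x : 'M[R]_N) : Prop :=
  nilpart E x /\ forall y, nilpart F y -> trform x y = 0.

Lemma nilpart_rad_subspace : subspace nilpart_rad.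
Proof.
have sp := nilpart_subspace E; split; first by split=> [|y _];
  [exact: Nilpart0|rewrite trform0l].
move=> c x y [nx hx] [ny hy]; split=> [|z nz]; first exact: NilpartL.
by rewrite trformDl trformZl hx // hy // mulr0 addr0.
Qed.

End Triple.

(** Invariance of the trace form.  For ad F_i the possible torus component h of
    [F_i, x] satisfies tr(h h) = 0, hence vanishes. *)
Lemma nilpart_rad_commut E F H x : cartan_triple E F H -> nilpart_rad E F x ->
  (forall i, nilpart_rad E F (commut (E i) x)) /\
  (forall i, nilpart_rad E F (commut (F i) x)).
Proof.
move=> ct [nx hx]; have ct' := cartan_triple_swap ct.
split=> i; split; first exact: Nilpart_commut.
- move=> y ny; rewrite commutC trformNl trform_inv.
  have [y1 [h [ny1 th ->]]] := commutF_nilpart ct' i ny.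
  rewrite trformDr hx // (trform_nilpart_torus ct nx) ?addr0 ?oppr0 //.
  exact/torus_opp.
- have [y [h [ny th e]]] := commutF_nilpart ct i nx.
  rewrite e (trform_torus_eq0 ct th) ?addr0 //.
  have: trform (commut (F i) x) h = 0.
    rewrite commutC trformNl trform_inv.
    have [|c e2] := commutHE ct' i (h := h); first exact: (torus_opp H h).1.
    by rewrite [commut (F i) h]commutC e2 trformNr trformZr hx ?mulr0 ?oppr0 //;
      apply: Nilpart_gen.
  by rewrite e trformDl (trform_nilpart_torus ct ny th) add0r.
- move=> y ny; rewrite commutC trformNl trform_inv hx ?oppr0 //.
  exact: Nilpart_commut.
Qed.

(** The Euclidean form on matrices; being definite, it is nondegenerate on every
    subspace and computes traces of operators on subspaces. *)
Definition entry_form (x y : 'M[R]_N) : R := \sum_b \sum_b' x b b' * y b b'.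

Lemma entry_formC x y : entry_form x y = entry_form y x.
Proof. by apply: eq_bigr => b _; apply: eq_bigr => b' _; rewrite mulrC. Qed.

Lemma entry_form_linl z : linear (fun x => entry_form x z : R^o).
Proof.
move=> c x y; rewrite /entry_form scaler_sumr -big_split; apply: eq_bigr => b _ /=.
rewrite scaler_sumr -big_split; apply: eq_bigr => b' _ /=.
by rewrite !mxE mulrDl -mulrA.
Qed.

Lemma entry_form_linr z : linear (fun x => entry_form z x : R^o).
Proof. by move=> c x y; rewrite !(entry_formC z) entry_form_linl. Qed.

Lemma entry_formDl z x y : entry_form (x + y) z = entry_form x z + entry_form y z.
Proof. by have [_ -> _ _] := linear_forE (entry_form_linl z). Qed.
Lemma entry_formZl z c x : entry_form (c *: x) z = c * entry_form x z.
Proof. by have [_ _ -> _] := linear_forE (entry_form_linl z). Qed.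
Lemma entry_form_suml z (I : Type) (s : seq I) (P : pred I) (x : I -> 'M[R]_N) :
  entry_form (\sum_(i <- s | P i) x i) z = \sum_(i <- s | P i) entry_form (x i) z.
Proof. by have [_ _ _ ->] := linear_forE (entry_form_linl z). Qed.

Lemma entry_form_ge0 x : 0 <= entry_form x x.
Proof. by do 2![apply: sumr_ge0 => ? _]; rewrite -expr2 sqr_ge0. Qed.

Lemma entry_form_eq0 x : entry_form x x = 0 -> x = 0.
Proof.
have ge0 b b' : 0 <= x b b' * x b b' by rewrite -expr2 sqr_ge0.
move=> /eqP; rewrite psumr_eq0 => [/allP z|b _]; last exact: sumr_ge0.
apply/matrixP => b b'; rewrite mxE; have /z := mem_index_enum b.
rewrite psumr_eq0 // => /allP /(_ b' (mem_index_enum b')) /=.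
by rewrite -expr2 sqrf_eq0 => /eqP.
Qed.

(** The radical R is stable under ad E_i and ad F_i, so that
    ad D = sum_i r_i [ad E_i, ad F_i] has trace 0 on R.  Computed through the
    orthogonal projection of matrix units onto R, the same trace is a sum of
    terms (D b b - D b' b') * w b b', where w b b' is the squared norm of the
    projection of the unit (b, b'), and where the height difference is positive
    whenever w b b' is nonzero.  So all projections vanish, and R with them. *)
Lemma nilpart_nondeg E F H x : cartan_triple E F H -> nilpart E x ->
  (forall y, nilpart F y -> trform x y = 0) -> x = 0.
Proof.
move=> ct nx hx; have sR := nilpart_rad_subspace E F.
have Rx : nilpart_rad E F x by [].
pose D := \sum_i r i *: H i.
have [k [g sg]] := subspace_spanned sR.
have nd y : nilpart_rad E F y ->
    (forall z, nilpart_rad E F z -> entry_form y z = 0) -> y = 0.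
  by move=> Ry /(_ y Ry) /entry_form_eq0.
have [||p df] := exists_dual_families entry_form_linl entry_form_linr sR sR sg sg.
- exact: nd.
- by move=> y Ry h; apply: nd => // z /h; rewrite entry_formC.
have [Rp Rq pE qE] := df.
have trD : \sum_j entry_form (commut D (p j)) (g j) = 0.
  transitivity (\sum_j \sum_i r i * (entry_form (commut (E i) (commut (F i) (p j))) (g j)
      - entry_form (commut (F i) (commut (E i) (p j))) (g j))).
    apply: eq_bigr => j _; rewrite commut_suml entry_form_suml.
    apply: eq_bigr => i _; rewrite commutZl entry_formZl; congr (_ * _).
    by rewrite jacobi (ct_EF ct) eqxx mulr1n (entry_formDl _ (commut (H i) _)) addrK.
  rewrite exchange_big big1 // => i _; rewrite -mulr_sumr sumrB.
  rewrite (dual_traceC entry_form_linl df) ?subrr ?mulr0 //; try exact: commut_linr.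
    by move=> y /(nilpart_rad_commut ct) [? _].
  by move=> y /(nilpart_rad_commut ct) [_ ?].
(* P b b' is the orthogonal projection of the matrix unit (b, b') to the radical. *)
pose P b b' := \sum_j g j b b' *: p j.
have RP b b' : nilpart_rad E F (P b b').
  by apply: subspace_sum => // j _; apply: subspaceZ.
have PE b b' y : nilpart_rad E F y -> entry_form (P b b') y = y b b'.
  move=> Ry; rewrite entry_form_suml {2}[y]qE // summxE; apply: eq_bigr => j _.
  by rewrite entry_formZl mxE mulrC.
pose w b b' := \sum_j p j b b' * g j b b'.
have wE b b' : w b b' = P b b' b b'.
  by rewrite summxE; apply: eq_bigr => j _; rewrite mxE mulrC.
have wge b b' : 0 <= w b b' by rewrite wE -PE // entry_form_ge0.
have Dw b b' : 0 <= (D b b - D b' b') * w b b'.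
  have [->|nz] := eqVneq (w b b') 0; first by rewrite mulr0.
  rewrite mulr_ge0 // subr_ge0 ltW //; apply: (nilpart_raise ct (RP b b').1).
  by rewrite -wE.
have sumDw : \sum_b \sum_b' (D b b - D b' b') * w b b' = 0.
  rewrite -[RHS]trD.
  have cE j : entry_form (commut D (p j)) (g j) =
      \sum_b \sum_b' (D b b - D b' b') * (p j b b' * g j b b').
    apply: eq_bigr => b _; apply: eq_bigr => b' _.
    by rewrite (commut_torus ct) ?mulrA //; apply: torusD.
  rewrite (eq_bigr _ (fun j _ => cE j)) [RHS]exchange_big /=; apply: eq_bigr => b _.
  by rewrite [RHS]exchange_big /=; apply: eq_bigr => b' _; rewrite mulr_sumr.
have w0 b b' : w b b' = 0.
  apply/eqP; apply: contraT => nz; have := Dw b b'.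
  have lt : 0 < D b b - D b' b'.
    by rewrite subr_gt0; apply: (nilpart_raise ct (RP b b').1); rewrite -wE.
  move: sumDw => /eqP; rewrite psumr_eq0 => [/allP z|c _]; last exact: sumr_ge0.
  have /z := mem_index_enum b; rewrite psumr_eq0 // => /allP /(_ b' (mem_index_enum b')) /=.
  by rewrite mulf_eq0 (negPf nz) orbF (gt_eqF lt).
apply/matrixP => b b'; rewrite mxE -PE //.
rewrite [P b b'](_ : _ = 0); first by rewrite -(scale0r 0) entry_formZl mul0r.
by apply: entry_form_eq0; rewrite PE // -wE.
Qed.

End CartanTriple.

Lemma commut_mulmx (R : fieldType) N (x y : 'M[R]_N) m (u : 'M[R]_(N, m)) :
  commut x y *m u = x *m (y *m u) - y *m (x *m u).
Proof. by rewrite /commut mulmxBl -!mulmxE !mulmxA. Qed.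

(** * The Casimir operator *)

(** The Casimir argument: moving y through the sum produces the matrix of ad y in
    the two families, once with each sign, because ad y is skew for the trace
    form. *)
Lemma dual_families_commut (R : fieldType) N (g : 'M[R]_N -> Prop) (I : finType)
    (p q : I -> 'M[R]_N) (y : 'M[R]_N) :
  dual_families (@trform R N) g g p q -> (forall x, g x -> g (commut y x)) ->
  commut y (\sum_i p i * q i) = 0.
Proof.
move=> [gp gq pE qE] gy; rewrite commut_sumr.
under eq_bigr do rewrite commutMr.
rewrite big_split /=.
rewrite [X in X + _](_ : _ = - \sum_i p i * commut y (q i)) ?addNr //.
transitivity (\sum_i \sum_j trform (commut y (p i)) (q j) *: (p j * q i)).
  apply: eq_bigr => i _; rewrite {1}[commut y (p i)]pE; last exact: gy.
  by rewrite mulr_suml; apply: eq_bigr => j _; rewrite [RHS]scalemxAl.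
rewrite exchange_big -sumrN; apply: eq_bigr => j _ /=.
rewrite [commut y (q j)]qE; last exact: gy.
rewrite mulr_sumr -sumrN; apply: eq_bigr => i _.
rewrite commutC trformNl trform_inv scaleNr; congr (- _).
by rewrite -[RHS]scalemxAr.
Qed.

Section Casimir.
Variables (R : realFieldType) (n N : nat) (a : 'I_n -> 'I_n -> R) (r : 'I_n -> R).
Hypothesis a_diag : forall i, a i i = 2.
Hypothesis rhov : forall j, \sum_i r i * a i j = 1.

(** The theory of sl_2.  The vectors F_i^k y have distinct H_i-weights l - 2 k, so
    some F_i^k y vanishes; at the first such k = m + 1, applying E_i gives
    (m + 1) (l - m) F_i^m y = 0, and l = m. *)
Lemma maximal_weight_ge0 (E F H : 'I_n -> 'M[R]_N) i (y : 'cV[R]_N) l :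
  cartan_triple a E F H -> E i *m y = 0 -> H i *m y = l *: y -> y != 0 -> 0 <= l.
Proof.
move=> ct Ey Hy y0; pose z k := iter k (fun u => F i *m u) y.
have Hz k : H i *m z k = (l - 2 * k%:R) *: z k.
  elim: k => [|k IH]; first by rewrite mulr0 subr0.
  have := commut_mulmx (H i) (F i) (z k);
    rewrite (ct_HF ct) a_diag IH -scalemxAl -scalemxAr.
  move/eqP; rewrite eq_sym subr_eq => /eqP -> /=; rewrite -scalerDl; congr (_ *: _).
  by rewrite -[k.+1]addn1 natrD; ring.
have Ez k : E i *m z k.+1 = (k.+1%:R * (l - k%:R)) *: z k.
  elim: k => [|k IH].
    have := commut_mulmx (E i) (F i) y; rewrite (ct_EF ct) eqxx mulr1n Hy Ey mulmx0 subr0.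
    by move=> /= <-; congr (_ *: _); ring.
  have := commut_mulmx (E i) (F i) (z k.+1).
  rewrite (ct_EF ct) eqxx mulr1n Hz IH -scalemxAr.
  move/eqP; rewrite eq_sym subr_eq => /eqP -> /=; rewrite -scalerDl; congr (_ *: _).
  by rewrite -[k.+2]addn1 -[k.+1]addn1 !natrD; ring.
(* Otherwise the N + 1 distinct weights l - 2 k, k <= N, would be diagonal
   entries of H i, of which there are N. *)
have [k zk] : exists k, z k == 0.
  have [//|nz] := pselect (exists k, z k == 0); exfalso.
  have supp k : exists b, z k b 0 != 0.
    have [//|h] := pselect (exists b, z k b 0 != 0); case: nz; exists k.
    apply/eqP/matrixP => b c; rewrite ord1 mxE; apply/eqP; apply: contra_notT h.
    by move=> nzb; exists b.
  pose f (k : 'I_N.+1) := projT1 (cid (supp k)).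
  have fE (j : 'I_N.+1) : H i (f j) (f j) = l - 2 * (j : nat)%:R.
    rewrite /f; case: (cid _) => b /= zb; have /matrixP /(_ b 0) := Hz j.
    rewrite [in RHS]mxE mxE (bigD1 b) //= big1 ?addr0 => [|c]; first exact: mulIf.
    by rewrite eq_sym => cb; rewrite (ct_diag ct) ?mul0r.
  have inj_f : injective f.
    move=> j k fjk; apply: val_inj; have := fE j; rewrite fjk fE => /eqP.
    by rewrite (inj_eq (addrI _)) eqr_opp (inj_eq (mulfI _)) ?pnatr_eq0 // eqr_nat => /eqP.
  by have := leq_card f inj_f; rewrite !card_ord ltnn.
have exz : exists k, z k == 0 by exists k.
case: (ex_minnP exz) => -[|m] zm min; first by rewrite (negPf y0) in zm.
have := Ez m; rewrite (eqP zm) mulmx0 => /eqP; rewrite eq_sym scaler_eq0 orbC.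
case: eqP => [/eqP /min|_ /=]; first by rewrite ltnn.
by rewrite mulf_eq0 pnatr_eq0 /= subr_eq0 => /eqP ->.
Qed.

Lemma dual_families_sym (P Q : 'M[R]_N -> Prop) (I : finType) (p q : I -> 'M[R]_N) :
  dual_families (@trform R N) P Q p q -> dual_families (@trform R N) Q P q p.
Proof.
move=> [Pp Qq pE qE]; split=> // x Px.
  by rewrite {1}[x]qE //; apply: eq_bigr => i _; rewrite trformC.
by rewrite {1}[x]pE //; apply: eq_bigr => i _; rewrite trformC.
Qed.

Lemma nilpart_commut (E : 'I_n -> 'M[R]_N) x y :
  nilpart E x -> nilpart E y -> nilpart E (commut x y).
Proof.
have sp := nilpart_subspace E; move=> nx;
  elim: nx y => {x} [i||c x y _ IHx _ IHy|i x _ IHx] z nz.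
- exact: Nilpart_commut.
- by rewrite commut0l; apply: Nilpart0.
- by rewrite commutDl commutZl; apply: NilpartL; [exact: IHx|exact: IHy].
- have -> : commut (commut (E i) x) z = commut (E i) (commut x z) - commut x (commut (E
  i) z).
    by rewrite jacobi addrK.
  apply: subspaceB => //; first exact/Nilpart_commut/IHx.
  exact/IHx/Nilpart_commut.
Qed.

(** The sum is the trace of ad y on n+, and y is a combination of commutators of
    operators preserving n+: either a commutator of elements of n+, or
    2 E_i = [H_i, E_i]. *)
Lemma nilpart_ad_trace (E F H : 'I_n -> 'M[R]_N) (I : finType) (p q : I -> 'M[R]_N) y :
  cartan_triple a E F H -> dual_families (@trform R N) (nilpart E) (nilpart F) p q ->
  nilpart E y -> \sum_b trform (commut y (p b)) (q b) = 0.
Proof.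
move=> ct df.
(* ad [u, v] = [ad u, ad v] has trace 0 on n+ *)
have trC u v : (forall x, nilpart E x -> nilpart E (commut u x)) ->
    (forall x, nilpart E x -> nilpart E (commut v x)) ->
    \sum_b trform (commut (commut u v) (p b)) (q b) = 0.
  move=> nu nv; have e b : trform (commut (commut u v) (p b)) (q b) =
      trform (commut u (commut v (p b))) (q b) - trform (commut v (commut u (p b))) (q b).
    by rewrite jacobi (trformDl _ (commut _ (p b))) addrK.
  rewrite (eq_bigr _ (fun b _ => e b)) sumrB.
  by rewrite (dual_traceC (@trform_linl R N) df) ?subrr //; apply: commut_linr.
elim=> {y} [i||c x y _ IHx _ IHy|i x nx IHx].
- have := trC (H i) (E i); rewrite (ct_HE ct) a_diag => /(_ _ _)-z.
  have : 2 * \sum_b trform (commut (E i) (p b)) (q b) = 0.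
    rewrite -[RHS]z; last 2 first.
    + by move=> x; apply: (nilpart_commutH ct); apply: torus_gen.
    + by move=> x; apply: Nilpart_commut.
    by rewrite mulr_sumr; apply: eq_bigr => b _; rewrite commutZl trformZl.
  by move/eqP; rewrite mulf_eq0 pnatr_eq0 /= => /eqP.
- by rewrite big1 // => b _; rewrite commut0l trform0l.
- under eq_bigr do rewrite commutDl commutZl (trformDl _ (c *: commut _ _)) trformZl.
  by rewrite big_split -mulr_sumr /= IHx IHy mulr0 addr0.
- by apply: trC => y; [exact: Nilpart_commut|exact: nilpart_commut].
Qed.

Section Triple.
Variables (E F H : 'I_n -> 'M[R]_N).
Hypothesis ct : cartan_triple a E F H.
Let ct' := cartan_triple_swap ct.

(** The sum n+ + h + n- inside all matrices. *)
Definition lie_span (x : 'M[R]_N) : Prop := exists u t w,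
  [/\ nilpart E u, torus H t, nilpart F w & x = u + t + w].

Lemma lie_span_subspace : subspace lie_span.
Proof.
have spE := nilpart_subspace E; have spF := nilpart_subspace F.
have spH := torus_subspace H.
split=> [|c _ _ [u [t [w [nu nt nw ->]]]] [u' [t' [w' [nu' nt' nw' ->]]]]].
  by exists 0, 0, 0; rewrite !addr0; split=> //; apply: subspace0.
exists (c *: u + u'), (c *: t + t'), (c *: w + w').
split; [exact: spE.2|exact: spH.2|exact: spF.2|].
by rewrite !scalerDr addrACA; congr (_ + _); rewrite addrACA.
Qed.

Lemma lie_spanE x : nilpart E x -> lie_span x.
Proof.
move=> nx; exists x, 0, 0; rewrite !addr0; split=> //; last exact: Nilpart0.
by apply: subspace0; apply: torus_subspace.
Qed.

Lemma lie_spanF x : nilpart F x -> lie_span x.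
Proof.
move=> nx; exists 0, 0, x; rewrite !add0r; split=> //; first exact: Nilpart0.
by apply: subspace0; apply: torus_subspace.
Qed.

Lemma lie_spanH x : torus H x -> lie_span x.
Proof. by move=> tx; exists 0, x, 0; rewrite add0r addr0; split=> //; exact: Nilpart0. Qed.

Lemma lie_span_commutE i x : lie_span x -> lie_span (commut (E i) x).
Proof.
have sg := lie_span_subspace.
move=> [u [t [w [nu nt nw ->]]]]; rewrite !commutDr; apply: subspaceD => //.
  apply: subspaceD => //; apply: lie_spanE; first exact: Nilpart_commut.
  rewrite commutC; apply: subspaceN; first exact: nilpart_subspace.
  by apply: (nilpart_commutH ct nt); apply: Nilpart_gen.
have [y [h [ny th ->]]] := commutF_nilpart ct' i nw.
apply: subspaceD => //; [exact: lie_spanF|apply: lie_spanH].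
exact/torus_opp.
Qed.

Lemma lie_span_commutF i x : lie_span x -> lie_span (commut (F i) x).
Proof.
have sg := lie_span_subspace.
move=> [u [t [w [nu nt nw ->]]]]; rewrite !commutDr; apply: subspaceD => //; last first.
  by apply: lie_spanF; apply: Nilpart_commut.
apply: subspaceD => //.
  have [y [h [ny th ->]]] := commutF_nilpart ct i nu.
  by apply: subspaceD => //; [exact: lie_spanE|exact: lie_spanH].
apply: lie_spanF; rewrite commutC; apply: subspaceN; first exact: nilpart_subspace.
apply: (nilpart_commutH ct'); last exact: Nilpart_gen.
exact: (torus_opp H t).1.
Qed.

Lemma lie_span_commut x y : nilpart E x -> lie_span y -> lie_span (commut x y).
Proof.
have sg := lie_span_subspace.
move=> nx; elim: nx y => {x} [i||c x y _ IHx _ IHy|i x _ IHx] z gz.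
- exact: lie_span_commutE.
- by rewrite commut0l; apply: subspace0.
- by rewrite commutDl commutZl; apply: sg.2; [exact: IHx|exact: IHy].
- have -> : commut (commut (E i) x) z = commut (E i) (commut x z) - commut x (commut (E
  i) z).
    by rewrite jacobi addrK.
  apply: subspaceB => //; first exact/lie_span_commutE/IHx.
  exact/IHx/lie_span_commutE.
Qed.

Section Dual.
Variables (k l : nat) (p q : 'I_k -> 'M[R]_N) (h h' : 'I_l -> 'M[R]_N).
Hypothesis dfn : dual_families (@trform R N) (nilpart E) (nilpart F) p q.
Hypothesis dfh : dual_families (@trform R N) (torus H) (torus H) h h'.

Let trEH x y : nilpart E x -> torus H y -> trform x y = 0.
Proof. exact: (trform_nilpart_torus rhov ct). Qed.
Let trFH x y : nilpart F x -> torus H y -> trform x y = 0.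
Proof. by move=> nx ty; apply: (trform_nilpart_torus rhov ct' nx);
  apply: (torus_opp H y).1. Qed.
Let trEE x y : nilpart E x -> nilpart E y -> trform x y = 0.
Proof. exact: (trform_nilpart rhov ct). Qed.
Let trFF x y : nilpart F x -> nilpart F y -> trform x y = 0.
Proof. exact: (trform_nilpart rhov ct'). Qed.

Let T := \sum_b commut (p b) (q b).

Lemma trform_sum_commut z : trform z T = \sum_b trform (commut z (p b)) (q b).
Proof. by rewrite trform_sumr; apply: eq_bigr => b _; rewrite trform_inv. Qed.

(** T plays the role of 2 rho.  It lies in n+ + h + n-, and it is orthogonal to n+
    and n- by [nilpart_ad_trace]; by nondegeneracy its components in n- and n+
    vanish. *)
Lemma sum_commut_torus : torus H T.
Proof.
have sg := lie_span_subspace; have [np nq pE qE] := dfn.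
have : lie_span T.
  by apply: subspace_sum => // b _; apply: lie_span_commut => //; apply: lie_spanF.
move=> [u [t [w [nu tt nw e]]]].
have u0 : u = 0.
  apply: (nilpart_nondeg rhov ct nu) => y ny.
  have : trform y T = 0.
    rewrite trform_sum_commut; transitivity (\sum_b - trform (commut y (q b)) (p b)).
      by apply: eq_bigr => b _; rewrite commutC trformNl trform_inv [in RHS]trformC.
    by rewrite sumrN (nilpart_ad_trace ct' (dual_families_sym dfn) ny) oppr0.
  by rewrite e !trformDr (trFH ny tt) (trFF ny nw) !addr0 trformC.
have w0 : w = 0.
  apply: (nilpart_nondeg rhov ct' nw) => y ny.
  have : trform y T = 0 by rewrite trform_sum_commut (nilpart_ad_trace ct dfn ny).
  by rewrite e !trformDr (trEH ny tt) (trEE ny nu) !add0r trformC.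
by rewrite e u0 w0 add0r addr0.
Qed.

Lemma trformHH i j : trform (H i) (H j) = a j i * trform (E i) (F i).
Proof.
have /esym := ct_EF ct i i; rewrite eqxx mulr1n => ->;
  rewrite trform_inv commutC trformNr (ct_HF ct).
by rewrite trformZr mulNr opprK.
Qed.

(** When (E_i, F_i) is nonzero, the simple root alpha_i is the function
    t |-> (H_i, t) / (E_i, F_i) on the torus. *)
Lemma trform_commut_torus i t : torus H t ->
  trform (E i) (F i) *: commut t (E i) = trform (H i) t *: E i.
Proof.
move=> [c ->]; rewrite commut_suml scaler_sumr trform_sumr [RHS]scaler_suml.
apply: eq_bigr => j _; rewrite commutZl (ct_HE ct) trformZr trformHH !scalerA.
by congr (_ *: _); ring.
Qed.

Lemma trform_EF_gt0 i : F i != 0 -> 0 < trform (E i) (F i).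
Proof.
move=> Fi; have : 0 < trform (H i) (H i).
  rewrite lt_def; apply/andP; split.
    apply: contraNneq Fi => /(trform_torus_eq0 ct (torus_gen H i)) Hi.
    have := ct_HF ct i i; rewrite Hi commut0l a_diag => /esym /eqP.
    by rewrite scaler_eq0 oppr_eq0 pnatr_eq0.
  by apply: sumr_ge0 => b _; rewrite (torusMl ct) -?expr2 ?sqr_ge0 //; apply: torus_gen.
by rewrite trformHH a_diag pmulr_rgt0.
Qed.

(** The left side is the trace of ad H_i on n+.  Write [F_i, x] = psi x + chi x with
    psi x in n+ and chi x in the torus.  Then ad H_i = [ad E_i, psi] + ad E_i chi
    on n+; the commutator has trace 0, and ad E_i chi has rank one, with image
    spanned by E_i, which it multiplies by 2. *)
Lemma trform_H_sum_commut i : F i != 0 -> trform (H i) T = 2.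
Proof.
move=> /trform_EF_gt0 ti; rewrite trform_sum_commut.
have [np nq pE qE] := dfn.
pose psi x := \sum_c trform (commut (F i) x) (q c) *: p c.
pose chi x := commut (F i) x - psi x.
have lpsi : linear psi.
  move=> c x y; rewrite /psi scaler_sumr -big_split; apply: eq_bigr => b _ /=.
  by rewrite scalerA -scalerDl commutDr commutZr trformDl trformZl.
have npsi x : nilpart E (psi x).
  by apply: subspace_sum => [|b _]; last apply: subspaceZ => //; apply: nilpart_subspace.
have lchi : linear chi.
  by move=> c x y; rewrite /chi lpsi commut_linr opprD addrACA -[c *: _ - c *: _]scalerBr.
have tchi x : nilpart E x -> torus H (chi x).
  move=> nx; have [y [t [ny tt e]]] := commutF_nilpart ct i nx.
  rewrite /chi /psi e [X in _ - X](_ : _ = y) ?[y + t]addrC ?addrK //.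
  rewrite [in RHS](pE y ny); apply: eq_bigr => b _.
  by rewrite trformDl [trform t _]trformC trFH ?add0r.
have e b : trform (commut (H i) (p b)) (q b) =
    trform (commut (E i) (psi (p b))) (q b) - trform (psi (commut (E i) (p b))) (q b)
    + trform (commut (E i) (chi (p b))) (q b).
  have -> : commut (H i) (p b) =
      commut (E i) (commut (F i) (p b)) - commut (F i) (commut (E i) (p b)).
    by rewrite jacobi (ct_EF ct) eqxx addrK.
  have {1}-> : commut (F i) (p b) = psi (p b) + chi (p b) by rewrite addrC subrK.
  have -> : commut (F i) (commut (E i) (p b)) =
      psi (commut (E i) (p b)) + chi (commut (E i) (p b)) by rewrite addrC subrK.
  have tX : trform (chi (commut (E i) (p b))) (q b) = 0.
    by rewrite trformC trFH //; apply/tchi/Nilpart_commut.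
  rewrite commutDr; move: (commut (E i) (psi (p b))) (commut (E i) (chi (p b)))
    (psi (commut (E i) (p b))) (chi (commut (E i) (p b))) tX.
  move=> A B C X tX; rewrite !trformDl trformNl trformDl tX addr0.
  by rewrite addrAC.
rewrite (eq_bigr _ (fun b _ => e b)) big_split sumrB /=.
rewrite (dual_traceC (@trform_linl R N) dfn (f := psi)) //; last 2 first.
- exact: commut_linr.
- by move=> x; apply: Nilpart_commut.
rewrite subrr add0r; apply: (mulfI (lt0r_neq0 ti)).
have [_ _ chiZ chiS] := linear_forE lchi.
transitivity (- trform (H i) (chi (E i))); last first.
  have -> : chi (E i) = - H i.
    rewrite /chi [psi _](_ : _ = 0) ?subr0; first by rewrite commutC (ct_EF ct) eqxx.
    rewrite /psi big1 // => c _; rewrite commutC (ct_EF ct) eqxx trformNl trformC trFH //.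
      by rewrite oppr0 scale0r.
    exact: torus_gen.
  by rewrite trformNr opprK trformHH a_diag mulrC.
rewrite [E i in RHS]pE; last exact: Nilpart_gen.
rewrite chiS trform_sumr mulr_sumr -sumrN; apply: eq_bigr => b _.
rewrite chiZ trformZr [commut _ (chi _)]commutC trformNl mulrN -[X in - X = _]trformZl.
by rewrite trform_commut_torus ?trformZl; [rewrite mulrC|exact: tchi].
Qed.

Let I : finType := ('I_k + 'I_k + 'I_l)%type.
Let X (c : I) := match c with inl (inl b) => p b | inl (inr b) => q b | inr j => h j end.
Let Y (c : I) := match c with inl (inl b) => q b | inl (inr b) => p b | inr j => h' j end.

Let sumI (V : zmodType) (f : I -> V) :
  \sum_c f c = \sum_b f (inl (inl b)) + \sum_b f (inl (inr b)) + \sum_j f (inr j).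
Proof. by rewrite big_sumType big_sumType. Qed.

(** n+ is dual to n- and the torus to itself, so the three pairs of families
    assemble into a pair for the whole sum. *)
Lemma casimir_dual_families : dual_families (@trform R N) lie_span lie_span X Y.
Proof.
have [np nq pE qE] := dfn; have [th th' hE h'E] := dfh.
have e0 u t w b : nilpart E u -> torus H t -> nilpart F w ->
    trform (u + t + w) (q b) = trform u (q b).
  by move=> nu tt nw; rewrite !trformDl (trFF nw (nq b)) [trform t _]trformC
    (trFH (nq b) tt) !addr0.
have e1 u t w b : nilpart E u -> torus H t -> nilpart F w ->
    trform (p b) (u + t + w) = trform (p b) w.
  by move=> nu tt nw; rewrite !trformDr (trEE (np b) nu) (trEH (np b) tt) !add0r.
have e2 u t w z : nilpart E u -> torus H t -> nilpart F w -> torus H z ->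
    trform (u + t + w) z = trform t z.
  by move=> nu tt nw tz; rewrite !trformDl (trEH nu tz) (trFH nw tz) addr0 add0r.
split=> [[[b|b]|j]|[[b|b]|j]|x [u [t [w [nu tt nw ->]]]]|x [u [t [w [nu tt nw ->]]]]] /=.
- exact: lie_spanE.
- exact: lie_spanF.
- exact: lie_spanH.
- exact: lie_spanF.
- exact: lie_spanE.
- exact: lie_spanH.
- rewrite sumI /=; under eq_bigr do rewrite e0 //; rewrite -pE //.
  under eq_bigr do rewrite trformC e1 //; rewrite -qE //.
  by under eq_bigr do rewrite e2 //; rewrite -hE // addrAC.
- rewrite sumI /=; under eq_bigr do rewrite e1 //; rewrite -qE //.
  under eq_bigr do rewrite trformC e0 //; rewrite -pE //.
  under eq_bigr do rewrite trformC e2 // trformC; rewrite -h'E //.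
  by rewrite [w + u]addrC addrAC.
Qed.

Definition casimir : 'M[R]_N := \sum_c X c * Y c.

Lemma commut_casimir :
  (forall i, commut (E i) casimir = 0) /\ (forall i, commut (F i) casimir = 0).
Proof.
split=> i; apply: (dual_families_commut casimir_dual_families) => x.
- exact: lie_span_commutE.
- exact: lie_span_commutF.
Qed.

Lemma nilpart_maximal x m (y : 'M[R]_(N, m)) :
  (forall i, E i *m y = 0) -> nilpart E x -> x *m y = 0.
Proof.
move=> Ey; elim=> {x} [i||c u v _ IHu _ IHv|i u _ IHu]; rewrite ?mul0mx //.
- by rewrite mulmxDl -scalemxAl IHu IHv scaler0 addr0.
- by rewrite commut_mulmx IHu Ey !mulmx0 subr0.
Qed.

(** Reordering p q = [p, q] + q p leaves only T and the torus part, because n+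
    kills maximal vectors. *)
Lemma casimir_maximal (y : 'cV[R]_N) b : (forall i, E i *m y = 0) ->
  (casimir *m y) b 0 = (T b b + \sum_j h j b b * h' j b b) * y b 0.
Proof.
move=> Ey; have [np nq pE qE] := dfn; have [th th' hE h'E] := dfh.
have -> : casimir = T + 2 *: (\sum_b q b * p b) + \sum_j h j * h' j.
  rewrite /casimir sumI /=; congr (_ + _).
  rewrite scaler_sumr /T -!big_split; apply: eq_bigr => c _ /=.
  by rewrite /commut scaler_nat mulr2n addrA subrK.
have tv (t : 'M[R]_N) (u : 'cV[R]_N) : torus H t -> (t *m u) b 0 = t b b * u b 0.
  move=> tt; rewrite mxE (bigD1 b) //= big1 ?addr0 // => c cb.
  by rewrite (torus_diag ct tt) ?mul0r // eq_sym.
have z0 : (\sum_b q b * p b) *m y = 0.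
  by rewrite mulmx_suml big1 // => c _;
    rewrite -mulmxE -mulmxA (nilpart_maximal Ey (np c)) mulmx0.
rewrite !mulmxDl -scalemxAl z0 scaler0 addr0 mxE tv; last exact: sum_commut_torus.
rewrite mulrDl; congr (_ + _); rewrite mulmx_suml summxE mulr_suml.
by apply: eq_bigr => j _; rewrite -mulmxE -mulmxA !tv ?mulrA.
Qed.

(** The element tau b of the torus represents evaluation at the weight of b, so
    that the eigenvalue at b is (tau b, tau b + T).  The difference of the two
    eigenvalues is the value at lambda - mu = sum_j c_j alpha_j of
    t = T + tau b0 + tau b1, and whenever c_j > 0 the value of
    alpha_j at t is (2 + lambda_j + mu_j) / (E_j, F_j) > 0. *)
Lemma casimir_eigenvalue_neq (b0 b1 : 'I_N) (c : 'I_n -> nat) :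
  (forall i, H i b0 b0 - H i b1 b1 = \sum_j (c j)%:R * a i j) ->
  (forall j, c j != 0%N -> F j != 0) -> (exists j, c j != 0%N) ->
  (forall i, 0 <= H i b0 b0) -> (forall i, 0 <= H i b1 b1) ->
  T b0 b0 + \sum_j h j b0 b0 * h' j b0 b0 !=
    T b1 b1 + \sum_j h j b1 b1 * h' j b1 b1.
Proof.
move=> cE Fc [j0 cj0] ge0 ge1; have [th th' hE h'E] := dfh.
pose tau b := \sum_j h j b b *: h' j.
have ttau b : torus H (tau b).
  apply: subspace_sum => [|j _]; first exact: torus_subspace.
  by apply: subspaceZ => //; apply: torus_subspace.
have tauE b t : torus H t -> trform (tau b) t = t b b.
  move=> tt; rewrite trform_suml [in RHS](hE t tt) summxE; apply: eq_bigr => j _.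
  by rewrite trformZl mxE mulrC [in RHS]trformC.
have ptE b : \sum_j h j b b * h' j b b = tau b b b.
  by rewrite summxE; apply: eq_bigr => j _; rewrite mxE.
have dE t : torus H t -> t b0 b0 - t b1 b1 =
    \sum_j (c j)%:R / trform (E j) (F j) * trform (H j) t.
  move=> [e ->].
  transitivity (\sum_i \sum_j e i * ((c j)%:R * a i j)).
    rewrite !summxE -sumrB; apply: eq_bigr => i _; rewrite !mxE -mulrBr cE.
    by rewrite mulr_sumr.
  rewrite exchange_big; apply: eq_bigr => j _ /=; rewrite trform_sumr mulr_sumr.
  apply: eq_bigr => i _; rewrite trformZr trformHH.
  have [->|/Fc /trform_EF_gt0 /lt0r_neq0 nz] := eqVneq (c j) 0%N; first by ring.
  by field.
pose t := T + tau b0 + tau b1.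
have tt : torus H t.
  have st := torus_subspace H.
  by do 2![apply: subspaceD => //]; apply: sum_commut_torus.
have tau01 : tau b1 b0 b0 = tau b0 b1 b1 by rewrite -tauE // trformC tauE.
rewrite !ptE -subr_eq0.
have -> : T b0 b0 + tau b0 b0 b0 - (T b1 b1 + tau b1 b1 b1) = t b0 b0 - t b1 b1.
  by rewrite /t !mxE tau01; ring.
rewrite dE // gt_eqF // (bigD1 j0) //= ltr_wpDr //.
- apply: sumr_ge0 => j _; have [->|/[dup] cj /Fc Fj] := eqVneq (c j) 0%N.
    by rewrite mul0r mul0r.
  apply: mulr_ge0; first by rewrite divr_ge0 // ltW // trform_EF_gt0.
  rewrite !trformDr trform_H_sum_commut // ![trform (H j) _]trformC !tauE;
    try exact: torus_gen.
  by rewrite !addr_ge0.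
- apply: mulr_gt0; first by rewrite divr_gt0 ?ltr0n ?lt0n ?trform_EF_gt0 ?Fc.
  rewrite !trformDr trform_H_sum_commut ?Fc // ![trform (H j0) _]trformC !tauE;
    try exact: torus_gen.
  by rewrite !ltr_wpDr.
Qed.

End Dual.

(** In a module generated by a maximal vector, every maximal weight vector has the
    highest weight: the Casimir operator acts on the whole module by its
    eigenvalue at the generator. *)
Lemma maximal_vector_weight (b0 b1 : 'I_N) (c : 'I_n -> nat) (x : 'cV[R]_N) :
  (forall i, E i *m (delta_mx b0 0 : 'cV_N) = 0) ->
  (forall b, exists w : seq 'I_n, delta_mx b 0 =
     foldr (fun i u => F i *m u) (delta_mx b0 0 : 'cV_N) w) ->
  (forall i, E i *m x = 0) -> x b1 0 != 0 ->
  (forall i b, x b 0 != 0 -> H i b b = H i b1 b1) ->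
  (forall i, H i b0 b0 - H i b1 b1 = \sum_j (c j)%:R * a i j) ->
  (forall j, c j != 0%N -> F j != 0) -> forall j, c j = 0%N.
Proof.
move=> E0 gen Ex xb1 wtx wtdiff Fc j; apply/eqP; apply: contraT => cj.
have torusv i (y : 'cV[R]_N) b : (forall b', y b' 0 != 0 -> H i b' b' = H i b b) ->
    H i *m y = H i b b *: y.
  move=> wt; apply/matrixP => b' z; rewrite ord1 mxE (bigD1 b') //= big1 ?addr0 => [|d db].
    by rewrite mxE; have [->|/wt ->] := eqVneq (y b' 0) 0; rewrite ?mulr0.
  by rewrite (ct_diag ct) ?mul0r // eq_sym.
have nz0 : (delta_mx b0 0 : 'cV[R]_N) b0 0 != 0 by rewrite mxE !eqxx oner_neq0.
have nzv (y : 'cV[R]_N) b : y b 0 != 0 -> y != 0.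
  by apply: contraNneq => ->; rewrite mxE.
have ge0 i : 0 <= H i b0 b0.
  apply: (maximal_weight_ge0 ct (E0 i)); last exact: nzv nz0.
  apply: torusv => b; rewrite mxE eqxx andbT; case: (eqVneq b b0) => [->|] //=.
  by rewrite eqxx.
have ge1 i : 0 <= H i b1 b1.
  by apply: (maximal_weight_ge0 ct (Ex i)); [exact/torusv/wtx|exact: nzv xb1].
have [k [g sg]] := subspace_spanned (nilpart_subspace E).
have [l [gF sgF]] := subspace_spanned (nilpart_subspace F).
have [m [gH sgH]] := subspace_spanned (torus_subspace H).
have [||p dfn] := exists_dual_families (@trform_linl R N) (@trform_linr R N)
   (nilpart_subspace E) (nilpart_subspace F) sg sgF.
- by move=> y; apply: (nilpart_nondeg rhov ct).
- move=> y ny hy; apply: (nilpart_nondeg rhov ct' ny) => z nz; rewrite trformC.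
  exact: hy.
have [||h dfh] := exists_dual_families (@trform_linl R N) (@trform_linr R N)
   (torus_subspace H) (torus_subspace H) sgH sgH.
- by move=> y ty /(_ y ty); exact: (trform_torus_eq0 ct ty).
- by move=> y ty /(_ y ty); exact: (trform_torus_eq0 ct ty).
pose cas := casimir p gF h gH.
pose ev b := (\sum_b' commut (p b') (gF b')) b b + \sum_j h j b b * gH j b b.
have cas0 : cas *m (delta_mx b0 0 : 'cV[R]_N) = ev b0 *: delta_mx b0 0.
  apply/matrixP => b z; rewrite ord1 (casimir_maximal dfn dfh) // [RHS]mxE.
  by rewrite mxE eqxx andbT; case: (eqVneq b b0) => [->|_] //=; rewrite !mulr0.
(* The generator determines the action of the Casimir operator on all F-words. *)
have casd b : cas *m (delta_mx b 0 : 'cV[R]_N) = ev b0 *: delta_mx b 0.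
  have [w ->] := gen b; elim: w => [|i w IH] //=.
  have [_ /(_ i) cF] := commut_casimir dfn dfh.
  have := commut_mulmx (F i) cas (foldr (fun i u => F i *m u) (delta_mx b0 0 : 'cV_N) w).
  by rewrite cF mul0mx IH -scalemxAr => /esym /eqP; rewrite subr_eq0 => /eqP <-.
have casx : cas *m x = ev b0 *: x.
  have xE : x = \sum_b x b 0 *: delta_mx b 0.
    by rewrite [LHS]matrix_sum_delta; apply: eq_bigr => b _; rewrite big_ord1.
  rewrite [in LHS]xE mulmx_sumr [in RHS]xE scaler_sumr; apply: eq_bigr => b _.
  by rewrite -scalemxAr casd !scalerA mulrC.
have /matrixP /(_ b1 0) := casx; rewrite (casimir_maximal dfn dfh) // mxE.
move/(mulIf xb1)/esym/eqP; apply: contraLR => _.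
by apply: (casimir_eigenvalue_neq dfn dfh wtdiff) => //; exists j.
Qed.

End Triple.
End Casimir.

(** * Places and lattices *)

(** A place in the sense of valuation theory, given by the graph of its partial map
    to the residue field; the last condition says that its domain is a valuation
    ring. *)
Record place (K k : fieldType) (sp : K -> k -> Prop) : Prop := Place {
  place_fun : forall x c d, sp x c -> sp x d -> c = d;
  place1 : sp 1 1;
  placeN : forall x c, sp x c -> sp (- x) (- c);
  placeD : forall x y c d, sp x c -> sp y d -> sp (x + y) (c + d);
  placeM : forall x y c d, sp x c -> sp y d -> sp (x * y) (c * d);
  place_total : forall x, (exists c, sp x c) \/ (exists c, sp x^-1 c)
}.

Section Place.
Variables (K k : fieldType) (sp : K -> k -> Prop).
Hypothesis spP : place sp.

Definition regular (x : K) : Prop := exists c, sp x c.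

Definition residue (x : K) : k :=
  if pselect (regular x) is left h then projT1 (cid h) else 0.

Lemma residueE x c : sp x c -> residue x = c.
Proof.
rewrite /residue; case: pselect => [h sxc|nr sxc]; last by case: nr; exists c.
by case: (cid h) => d /= sxd; apply: place_fun sxc.
Qed.

Lemma residueP x : regular x -> sp x (residue x).
Proof. by move=> [c sxc]; rewrite (residueE sxc). Qed.

Lemma place0 : sp 0 0.
Proof. by rewrite -(subrr 1) -[X in sp _ X](subrr 1); apply: (placeD spP);
  [|apply: (placeN spP)]; apply: place1. Qed.

Lemma regular0 : regular 0. Proof. by exists 0; apply: place0. Qed.
Lemma regular1 : regular 1. Proof. by exists 1; apply: place1. Qed.
Lemma regularD x y : regular x -> regular y -> regular (x + y).
Proof. by move=> [c xc] [d yd]; exists (c + d); apply: placeD. Qed.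
Lemma regularN x : regular x -> regular (- x).
Proof. by move=> [c xc]; exists (- c); apply: placeN. Qed.
Lemma regularM x y : regular x -> regular y -> regular (x * y).
Proof. by move=> [c xc] [d yd]; exists (c * d); apply: placeM. Qed.
Lemma regular_sum (I : Type) (r : seq I) (P : pred I) (f : I -> K) :
  (forall i, P i -> regular (f i)) -> regular (\sum_(i <- r | P i) f i).
Proof. by move=> rf; apply: big_ind => //; [exact: regular0|exact: regularD]. Qed.

Lemma residue0 : residue 0 = 0. Proof. by apply: residueE; apply: place0. Qed.
Lemma residue1 : residue 1 = 1. Proof. by apply: residueE; apply: (place1 spP). Qed.
Lemma regular_bool (b : bool) : regular b%:R.
Proof. by case: b; [exact: regular1|exact: regular0]. Qed.
Lemma residue_bool (b : bool) : residue b%:R = b%:R.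
Proof. by case: b; [exact: residue1|exact: residue0]. Qed.
Lemma residueD x y : regular x -> regular y -> residue (x + y) = residue x + residue y.
Proof. by move=> rx ry; apply: residueE; apply: (placeD spP); exact: residueP. Qed.
Lemma residueM x y : regular x -> regular y -> residue (x * y) = residue x * residue y.
Proof. by move=> rx ry; apply: residueE; apply: (placeM spP); exact: residueP. Qed.
Lemma residue_sum (I : Type) (r : seq I) (f : I -> K) :
  (forall i, regular (f i)) -> residue (\sum_(i <- r) f i) = \sum_(i <- r) residue (f i).
Proof.
move=> rf; elim: r => [|i r IH]; first by rewrite !big_nil residue0.
by rewrite !big_cons residueD ?IH //; apply: regular_sum.
Qed.

Lemma residue_mulmx m n p (X : 'M[K]_(m, n)) (Y : 'M[K]_(n, p)) :
  (forall i j, regular (X i j)) -> (forall i j, regular (Y i j)) ->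
  map_mx residue (X *m Y) = map_mx residue X *m map_mx residue Y.
Proof.
move=> rX rY; apply/matrixP => i j; rewrite !mxE residue_sum => [|l]; last exact: regularM.
by apply: eq_bigr => l _; rewrite residueM ?mxE.
Qed.

Lemma regular_mulmx m n p (X : 'M[K]_(m, n)) (Y : 'M[K]_(n, p)) :
  (forall i j, regular (X i j)) -> (forall i j, regular (Y i j)) ->
  forall i j, regular ((X *m Y) i j).
Proof. by move=> rX rY i j; rewrite mxE; apply: regular_sum => l _; apply: regularM. Qed.

(** In a valuation ring divisibility is total, so a finite family can be divided
    by one of its nonzero members. *)
Lemma regular_normalize (I : finType) (y : I -> K) i : y i != 0 ->
  exists2 i0, y i0 != 0 & forall j, regular (y j / y i0).
Proof.
move=> yi; suff: exists2 i0, y i0 != 0 & forall j, j \in enum I -> regular (y j / y i0).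
  by move=> [i0 y0 h]; exists i0 => // j; apply: h; rewrite mem_enum.
have: exists2 i, i \in enum I & y i != 0 by exists i; rewrite ?mem_enum.
elim: (enum I) => [[]//|i1 s IH _].
have [[i2 s2 y2]|ns] := pselect (exists2 i, i \in s & y i != 0); last first.
  have [y1|y1] := eqVneq (y i1) 0.
    exists i => // j; rewrite inE => /orP [/eqP ->|js]; first by rewrite y1 mul0r;
      exact: regular0.
    have -> : y j = 0 by apply/eqP; apply: contra_notT ns => nz; exists j.
    by rewrite mul0r; exact: regular0.
  exists i1 => // j; rewrite inE => /orP [/eqP ->|js]; first by rewrite divff //;
    exact: regular1.
  have -> : y j = 0 by apply/eqP; apply: contra_notT ns => nz; exists j.
  by rewrite mul0r; exact: regular0.
have [|i0 y0 h] := IH; first by exists i2.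
have [r1|r1] := place_total spP (y i1 / y i0).
  by exists i0 => // j; rewrite inE => /orP [/eqP -> //|/h].
have [y1|y1] := eqVneq (y i1) 0.
  exists i0 => // j; rewrite inE => /orP [/eqP ->|/h //].
  by rewrite y1 mul0r; exact: regular0.
exists i1 => // j; rewrite inE => /orP [/eqP ->|/h rj]; first by rewrite divff //;
  exact: regular1.
have -> : y j / y i1 = (y j / y i0) * (y i1 / y i0)^-1 by field; apply/andP.
exact: regularM.
Qed.

(** A finitely generated torsion free module over a valuation ring is free: in a
    minimal generating subfamily, a linear relation divided by its dominant
    coefficient expresses one generator by the others. *)
Lemma regular_basis (V : lmodType K) (I : finType) (v : I -> V) :
  exists N (b : 'I_N -> I),
    (forall i, exists2 c : 'I_N -> K, (forall j, regular (c j)) & v i = \sum_j c j *: v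
      (b j))
    /\ (forall c : 'I_N -> K, \sum_j c j *: v (b j) = 0 -> forall j, c j = 0).
Proof.
pose Q (B : {set I}) := `[< forall i, exists2 c : I -> K, (forall j, regular (c j)) &
  v i = \sum_(j in B) c j *: v j >].
have QT : Q finset.setT.
  apply/asboolP => i; exists (fun j => (j == i)%:R).
    by move=> j; case: eqP => _; [exact: regular1|exact: regular0].
  rewrite (bigD1 i) ?inE //= eqxx scale1r big1 ?addr0 // => j /andP [_ /negPf ->].
  by rewrite scale0r.
have [B QB Bmin] := arg_minnP (fun B : {set I} => #|B|) QT.
have ind (c : I -> K) : \sum_(j in B) c j *: v j = 0 -> forall j, j \in B -> c j = 0.
  move=> c0 j jB; apply/eqP; apply: contraT => cj.
  have := @regular_normalize _ (fun i => if i \in B then c i else 0) j.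
  rewrite jB => /(_ cj) [i0]; case: ifP => [iB ci0 h|_]; last by rewrite eqxx.
  have vi0 : v i0 = \sum_(i in B :\ i0) (- (c i / c i0)) *: v i.
    move: c0; rewrite (bigD1 i0) //= => /eqP; rewrite addr_eq0 => /eqP e.
    rewrite -[v i0]scale1r -(mulVf ci0) -scalerA e scalerN scaler_sumr -sumrN.
    apply: eq_big => [i|i _]; first by rewrite !inE andbC.
    by rewrite scalerA -scaleNr mulrC.
  have: Q (B :\ i0).
    apply/asboolP => i; have /asboolP /(_ i) [d rd ->] := QB.
    exists (fun l => d i0 * (- (if l \in B then c l / c i0 else 0)) + d l).
      move=> l; apply: regularD => //; apply: regularM => //; apply: regularN.
      by have := h l; case: ifP => _ //; rewrite mul0r.
    rewrite (bigD1 i0) //= [v i0]vi0 scaler_sumr.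
    rewrite [X in _ + X](_ : _ = \sum_(l in B :\ i0) d l *: v l); last first.
      by apply: eq_bigl => l; rewrite !inE andbC.
    rewrite -big_split /=; apply: eq_bigr => l; rewrite !inE => /andP [_ ->].
    by rewrite scalerDl scalerA.
  by move=> /Bmin; rewrite leqNgt (cardsD1 i0 B) iB ltnS leqnn.
exists #|B|, enum_val; split=> [i|c].
  have /asboolP /(_ i) [d rd ->] := QB; exists (fun j => d (enum_val j)) => //.
  by rewrite (big_enum_val (fun j => d j *: v j)).
move=> c0 j; have jB := enum_valP j.
have := ind (fun i => c (enum_rank_in jB i)); rewrite big_enum_val /=.
under eq_bigr do rewrite enum_valK_in.
by move=> /(_ c0 _ jB); rewrite enum_valK_in.
Qed.

End Place.

Section Weights.
Variables (n : nat) (A : 'M[int]_n).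

Lemma pairingD i (x y : weight n) : pairing i (x + y) = pairing i x + pairing i y.
Proof. by rewrite /pairing mxE. Qed.

Lemma pairingN i (x : weight n) : pairing i (- x) = - pairing i x.
Proof. by rewrite /pairing mxE. Qed.

Lemma pairing_root i j : pairing i (simple_root A j) = A i j.
Proof. by rewrite /pairing mxE. Qed.

(** * Weights and heights *)

(** The weight by which a word in the E_i raises, and one in the F_i lowers. *)
Definition content (w : seq 'I_n) : weight n := \sum_(i <- w) simple_root A i.

Lemma content_cons i w : content (i :: w) = simple_root A i + content w.
Proof. by rewrite /content big_cons. Qed.

Lemma pairing_content i w :
  pairing i (content w) = \sum_j (count_mem j w)%:R * A i j.
Proof.
rewrite /pairing; elim: w => [|l w IH].
  by rewrite /content big_nil mxE big1 // => j _; rewrite mul0r.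
transitivity (A i l + \sum_j (count_mem j w)%:R * A i j).
  by rewrite content_cons mxE IH mxE.
rewrite -[A i l](_ : \sum_j (l == j)%:R * A i j = _); last first.
  rewrite (bigD1 l) //= eqxx mul1r big1 ?addr0 // => j /negPf jl.
  by rewrite eq_sym jl mul0r.
by rewrite -big_split; apply: eq_bigr => j _; rewrite /= natrD mulrDl.
Qed.

Variables (R : realFieldType) (r : 'I_n -> R).
Hypothesis rhov : forall j, \sum_i r i * (A i j)%:~R = 1.

(** The pairing with rho^vee = sum_i r_i alpha_i^vee. *)
Definition height (lam : weight n) : R := \sum_i r i * (pairing i lam)%:~R.

Lemma heightD lam mu : height (lam + mu) = height lam + height mu.
Proof.
rewrite /height -big_split; apply: eq_bigr => i _ /=.
by rewrite /pairing mxE intrD mulrDr.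
Qed.

Lemma heightB lam mu : height (lam - mu) = height lam - height mu.
Proof. by apply/eqP; rewrite eq_sym subr_eq -heightD subrK. Qed.

Lemma height_root j : height (simple_root A j) = 1.
Proof. by rewrite -[RHS](rhov j); apply: eq_bigr => i _; rewrite /pairing mxE. Qed.

Lemma height_content w : height (content w) = (size w)%:R.
Proof.
elim: w => [|i w IH]; last by rewrite content_cons heightD height_root IH -natr1 addrC.
by rewrite /content big_nil /height big1 // => i _; rewrite /pairing mxE mulr0.
Qed.

Lemma content_eq0 w : content w = 0 -> w = [::].
Proof.
move=> w0; apply: size0nil; apply/eqP; rewrite -(eqr_nat R) -height_content w0.
by rewrite /height big1 // => i _; rewrite /pairing mxE mulr0.
Qed.

End Weights.

(** * Highest weight modules *)

(** The operators are kept abstract so that the results apply to left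
    multiplication on S e and to right multiplication on e S.  The map pr mu
    projects to the weight space mu, and q i c stands for the quantum integer
    [c]_i, whose residue is the integer c. *)
Section HighestWeight.
Variables (K : fieldType) (k : realFieldType) (sp : K -> k -> Prop).
Hypothesis spP : place sp.
Variables (n : nat) (A : 'M[int]_n) (r : 'I_n -> k) (q : 'I_n -> int -> K).
Hypothesis A_diag : forall i, A i i = 2.
Hypothesis rhov : forall j, \sum_i r i * (A i j)%:~R = 1.
Hypothesis sp_q : forall i c, sp (q i c) c%:~R.

Variables (V : lmodType K) (Eop Fop : 'I_n -> V -> V) (pr : weight n -> V -> V).
Variables (m : V) (lam : weight n) (L : nat).
Hypothesis linE : forall i, linear (Eop i).
Hypothesis linF : forall i, linear (Fop i).
Hypothesis linpr : forall mu, linear (pr mu).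
Hypothesis prE : forall mu i v, pr (mu + simple_root A i) (Eop i v) = Eop i (pr mu v).
Hypothesis prF : forall mu i v, pr (mu - simple_root A i) (Fop i v) = Fop i (pr mu v).
Hypothesis prm : forall mu, pr mu m = m *+ (mu == lam).
Hypothesis m_neq0 : m != 0.
Hypothesis Em : forall i, Eop i m = 0.

Definition Fword (w : seq 'I_n) : V := foldr Fop m w.

Hypothesis EF : forall i j w, Eop i (Fop j (Fword w)) = Fop j (Eop i (Fword w)) +
  (q i (pairing i (lam - content A w)) *: Fword w) *+ (i == j).
Hypothesis Fword_long : forall w, (L < size w)%N -> Fword w = 0.

Let wt (w : seq 'I_n) := lam - content A w.

Lemma linear_fun0 (U : lmodType K) (f : U -> U) : linear f -> f 0 = 0.
Proof. by case/linear_forE. Qed.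
Lemma linear_funMn (U : lmodType K) (f : U -> U) v b : linear f -> f (v *+ b) = f v *+ b.
Proof.
move=> /linear_forE [f0 fD _ _]; elim: b => [|b IH]; first by rewrite !mulr0n.
by rewrite !mulrS fD IH.
Qed.

Lemma pr_Fword mu w : pr mu (Fword w) = Fword w *+ (mu == wt w).
Proof.
elim: w mu => [|i w IH] mu; first by rewrite /wt /content big_nil subr0 prm.
rewrite -[mu](addrK (simple_root A i)) /= prF IH linear_funMn //;
  congr (_ *+ (nat_of_bool _)).
rewrite /wt content_cons opprD addrA [_ - simple_root A i - _]addrAC.
by rewrite (inj_eq (addIr _)).
Qed.

(** The F-words span a lattice over the valuation ring of the place, stable under
    the operators because quantum integers are regular.  In a basis of F-words the
    operators have regular matrices, whose residues form a Cartan triple, and the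
    residue of x, scaled so as to be primitive, is a maximal vector of it. *)
Lemma highest_weight_of_maximal (x : V) (mu : weight n) (c : L.-bseq 'I_n -> K) :
  x = \sum_w c w *: Fword w -> x != 0 -> (forall i, Eop i x = 0) -> pr mu x = x ->
  mu = lam.
Proof.
move=> xE x0 Ex prx.
have [N [b [bspan bind]]] := regular_basis spP (fun w : L.-bseq 'I_n => Fword w).
pose g j := Fword (b j).
pose rs (v : V) := exists2 c : 'I_N -> K, (forall j, regular sp (c j)) &
  v = \sum_j c j *: g j.
have rs0 : rs 0.
  exists (fun=> 0) => [j|]; first exact: regular0.
  by rewrite big1 // => j _; rewrite scale0r.
have rsL d u v : regular sp d -> rs u -> rs v -> rs (d *: u + v).
  move=> rd [cu ru ->] [cv rv ->]; exists (fun j => d * cu j + cv j).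
    by move=> j; apply: regularD => //; apply: regularM.
  by rewrite scaler_sumr -big_split; apply: eq_bigr => j _ /=; rewrite scalerA scalerDl.
have rsF w : rs (Fword w).
  have [wL|/Fword_long ->] := leqP (size w) L; last exact: rs0.
  by have := bspan (Bseq wL).
have rs_sum (d : 'I_N -> K) (u : 'I_N -> V) : (forall j, regular sp (d j)) ->
    (forall j, rs (u j)) -> rs (\sum_j d j *: u j).
  by move=> rd ru; apply: (big_rec rs) => // j v _ rv; apply: rsL.
(* Moving E_i through an F-word only creates quantum integers. *)
have rsE i w : rs (Eop i (Fword w)).
  elim: w => [|j w IH]; first by rewrite Em.
  rewrite [Fword _]/= EF; have [d rd ->] := IH.
  have [_ _ FZ FS] := linear_forE (linF j).
  rewrite FS -[X in _ + X]scale1r addrC; apply: (rsL).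
  - exact: regular1.
  - case: eqP => [_|_]; rewrite ?mulr1n ?mulr0n; last exact: rs0.
    rewrite -[_ *: _]addr0; apply: rsL => //.
    by exists (pairing i (lam - content A w))%:~R; apply: sp_q.
  - by under eq_bigr do rewrite FZ; apply: rs_sum => // l; apply: (rsF (j :: b l)).
have uniq_coord (c1 c2 : 'I_N -> K) :
    \sum_j c1 j *: g j = \sum_j c2 j *: g j -> forall j, c1 j = c2 j.
  move=> e j; apply/eqP; rewrite -subr_eq0; apply/eqP.
  apply: (bind (fun j => c1 j - c2 j)).
  under eq_bigr do rewrite scalerBl.
  by rewrite sumrB e subrr.
have prg nu j : pr nu (g j) = g j *+ (nu == wt (b j)) by exact: pr_Fword.
(* Coordinates of a weight vector live on basis words of the same weight. *)
have coord_wt nu v (d : 'I_N -> K) : v = \sum_j d j *: g j -> pr nu v = v ->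
    forall j, d j != 0 -> wt (b j) = nu.
  move=> e ev j; apply: contraNeq => nwt; apply/eqP.
  have [_ _ pZ pS] := linear_forE (linpr nu).
  rewrite (uniq_coord d (fun l => d l *+ (nu == wt (b l)))) ?(eq_sym nu) ?(negPf nwt) //.
  rewrite -e -ev e pS; apply: eq_bigr => l _; rewrite pZ prg.
  by rewrite -scalerMnr scalerMnl.
have coords (u : 'I_N -> V) : (forall j, rs (u j)) ->
    exists2 M : 'M[K]_N, (forall i j, regular sp (M i j)) &
      forall j, u j = \sum_l M l j *: g l.
  move=> ru; pose d j := projT1 (cid2 (ru j)).
  have dP j : (forall l, regular sp (d j l)) /\ u j = \sum_l d j l *: g l.
    by rewrite /d; case: (cid2 _) => /= e re ->.
  exists (\matrix_(l, j) d j l) => [l j|j]; first by rewrite mxE; apply: (dP j).1.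
  by rewrite (dP j).2; apply: eq_bigr => l _; rewrite mxE.
have /choice [Fmx FmP] : forall i, exists M : 'M[K]_N, (forall l j, regular sp (M l j)) /\
      forall j, Fop i (g j) = \sum_l M l j *: g l.
  by move=> i; have [M] := coords (fun j => Fop i (g j)) (fun j => rsF (i :: b j));
    exists M.
have /choice [Emx EmP] : forall i, exists M : 'M[K]_N, (forall l j, regular sp (M l j)) /\
      forall j, Eop i (g j) = \sum_l M l j *: g l.
  by move=> i; have [M] := coords (fun j => Eop i (g j)) (fun j => rsE i (b j)); exists M.
have rF i : forall l j, regular sp (Fmx i l j) by case: (FmP i).
have gF i : forall j, Fop i (g j) = \sum_l Fmx i l j *: g l by case: (FmP i).
have rE i : forall l j, regular sp (Emx i l j) by case: (EmP i).
have gE i : forall j, Eop i (g j) = \sum_l Emx i l j *: g l by case: (EmP i).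
(* Composition of operators is multiplication of their matrices. *)
have comp (f : V -> V) (X : 'M[K]_N) p (Y : 'M[K]_(N, p)) j : linear f ->
    (forall j, f (g j) = \sum_l X l j *: g l) ->
    f (\sum_l Y l j *: g l) = \sum_l (X *m Y) l j *: g l.
  move=> /linear_forE [_ _ fZ fS] fX; rewrite fS.
  under eq_bigr do rewrite fZ fX scaler_sumr.
  rewrite exchange_big; apply: eq_bigr => l _ /=; rewrite mxE scaler_suml.
  by apply: eq_bigr => l' _; rewrite scalerA mulrC.
have mx_inj p (X Y : 'M[K]_(N, p)) :
    (forall j, \sum_l X l j *: g l = \sum_l Y l j *: g l) -> X = Y.
  by move=> e; apply/matrixP => l j; apply: (uniq_coord (X^~ j) (Y^~ j)); apply: e.
pose Eb i := map_mx (residue sp) (Emx i); pose Fb i := map_mx (residue sp) (Fmx i).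
pose Hq i : 'M[K]_N := \matrix_(l, j) (q i (pairing i (wt (b j))) *+ (l == j)).
pose Hb i : 'M[k]_N := \matrix_(l, j) ((pairing i (wt (b j)))%:~R *+ (l == j)).
have EFq i j : Emx i *m Fmx j = Fmx j *m Emx i + Hq i *+ (i == j).
  apply: mx_inj => l; rewrite -(comp _ _ _ _ _ (linE i) (gE i)) -gF EF.
  rewrite [Eop i (Fword (b l))]gE (comp _ _ _ _ _ (linF j) (gF j)).
  transitivity (\sum_l0 (Fmx j *m Emx i) l0 l *: g l0 + \sum_l0 (Hq i *+ (i == j)) l0 l
    *: g l0).
    congr (_ + _); case: eqP => _; rewrite ?mulr1n ?mulr0n.
      rewrite (bigD1 l) //= mxE eqxx mulr1n big1 ?addr0 // => l' /negPf l'l.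
      by rewrite mxE l'l mulr0n scale0r.
    by rewrite big1 // => l' _; rewrite mxE scale0r.
  by rewrite -big_split; apply: eq_bigr => l1 _ /=; rewrite -scalerDl [in RHS]mxE.
have reg_EF i j := regular_mulmx spP (rE i) (rF j).
have reg_FE i j := regular_mulmx spP (rF j) (rE i).
have spq i z : residue sp (q i z) = z%:~R by apply: residueE.
have wtE i l j : Emx i l j != 0 -> wt (b l) = wt (b j) + simple_root A i.
  apply: (coord_wt _ (Eop i (g j)) (fun l => Emx i l j)); first exact: gE.
  by rewrite prE prg eqxx.
have wtF i l j : Fmx i l j != 0 -> wt (b l) = wt (b j) - simple_root A i.
  apply: (coord_wt _ (Fop i (g j)) (fun l => Fmx i l j)); first exact: gF.
  by rewrite prF prg eqxx.
have HbMl i (X : 'M[k]_N) l j : (Hb i * X) l j = (pairing i (wt (b l)))%:~R * X l j.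
  rewrite mxE (bigD1 l) //= mxE eqxx big1 ?addr0 // => l' /negPf l'l.
  by rewrite mxE eq_sym l'l mul0r.
have HbMr i (X : 'M[k]_N) l j : (X * Hb i) l j = (pairing i (wt (b j)))%:~R * X l j.
  rewrite mxE (bigD1 j) //= mxE eqxx mulrC big1 ?addr0 // => l' /negPf l'l.
  by rewrite mxE l'l mulr0.
(* At the residue field the quantum integers become the weights themselves. *)
have ct : cartan_triple (fun i j => (A i j)%:~R) Eb Fb Hb.
  split=> [i j|i j|i j|i l j lj].
  - rewrite /commut -!mulmxE /Eb /Fb -!(residue_mulmx spP) //.
    apply/matrixP => l l'.
    have e : (Emx i *m Fmx j) l l' = (Fmx j *m Emx i) l l' + Hq i l l' *+ (i == j).
      by rewrite EFq [LHS]mxE; congr (_ + _); case: eqP => [_|_];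
        rewrite ?mulr1n ?mulr0n // mxE.
    transitivity (residue sp ((Emx i *m Fmx j) l l') - residue sp ((Fmx j *m Emx i) l l')).
      by rewrite !mxE.
    have rq : regular sp (q i (pairing i (wt (b l')))).
      by exists (pairing i (wt (b l')))%:~R; apply: sp_q.
    have HE : residue sp (Hq i l l') = Hb i l l'.
      by rewrite !mxE; case: eqP => [_|_]; rewrite ?mulr1n ?mulr0n ?residue0.
    have rH : regular sp (Hq i l l').
      by rewrite mxE; case: eqP => [_|_]; rewrite ?mulr1n ?mulr0n //; apply: regular0.
    rewrite e; case: eqP => [_|_]; rewrite ?mulr1n ?mulr0n.
      by rewrite residueD // ?HE [LHS]addrC ?addKr.
    by rewrite addr0 subrr mxE.
  - apply/matrixP => l l'; rewrite mxE [X in _ + X]mxE HbMl HbMr -mulrBl [RHS]mxE.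
    have [e|/wtE ->] := eqVneq (Emx j l l') 0; first by rewrite mxE e residue0 // !mulr0.
    by rewrite -intrB pairingD pairing_root addrAC subrr add0r mxE.
  - apply/matrixP => l l'; rewrite mxE [X in _ + X]mxE HbMl HbMr -mulrBl [RHS]mxE.
    have [e|/wtF ->] := eqVneq (Fmx j l l') 0; first by rewrite mxE e residue0 // !mulr0.
    by rewrite -intrB pairingD pairingN pairing_root addrAC subrr add0r intrN mxE.
  - by rewrite mxE (negPf lj).
(* The vector m has no expression by nonempty words, which have other weights,
   so the empty word belongs to the basis. *)
have [j0 bj0] : exists j0, b j0 = [::] :> seq _.
  have [d _ dE] := rsF [::].
  have [[j dj]|nd] := pselect (exists j, d j != 0); last first.
    case/negP: m_neq0; rewrite -[m]/(Fword [::]) dE big1 // => j _.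
    have -> : d j = 0 by apply/eqP; apply: contra_notT nd => nz; exists j.
    by rewrite scale0r.
  exists j; apply: (content_eq0 rhov); have := coord_wt _ _ _ dE _ _ dj.
  move=> /(_ lam); rewrite pr_Fword {1}/wt /content big_nil subr0.
  by rewrite eqxx => /(_ erefl) /eqP; rewrite /wt -subr_eq0 addrC addKr oppr_eq0 => /eqP.
have gj0 : g j0 = m by rewrite /g bj0.
have sumdelta j : \sum_l (delta_mx j 0 : 'cV[K]_N) l 0 *: g l = g j.
  rewrite (bigD1 j) //= mxE !eqxx scale1r big1 ?addr0 // => l /negPf lj.
  by rewrite mxE lj scale0r.
have E0 i : Eb i *m (delta_mx j0 0 : 'cV_N) = 0.
  have z : Emx i *m delta_mx j0 0 = 0 :> 'cV_N.
    apply: mx_inj => l; rewrite ord1 -(comp _ _ _ _ _ (linE i) (gE i)) sumdelta gj0 Em.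
    by rewrite big1 // => l' _; rewrite mxE scale0r.
  have -> : delta_mx j0 0 = map_mx (residue sp) (delta_mx j0 0) :> 'cV_N.
    by apply/matrixP => l l'; rewrite !mxE residue_bool.
  rewrite -(residue_mulmx spP) ?z //.
    by apply/matrixP => l l'; rewrite !mxE residue0.
  by move=> l l'; rewrite mxE; apply: regular_bool.
(* The residues of the coordinates of an F-word are the same word in the
   matrices Fb applied to the first basis vector. *)
have Fgen w : exists2 y : 'cV[K]_N, (forall l j, regular sp (y l j)) &
    Fword w = \sum_l y l 0 *: g l /\
    map_mx (residue sp) y = foldr (fun i u => Fb i *m u) (delta_mx j0 0 : 'cV_N) w.
  elim: w => [|i w [y ry [wE yE]]].
    exists (delta_mx j0 0).
      by move=> l l'; rewrite mxE; apply: regular_bool.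
    rewrite sumdelta gj0; split=> //.
    by apply/matrixP => l l'; rewrite !mxE residue_bool.
  exists (Fmx i *m y); first exact: regular_mulmx.
  split; first by rewrite /= wE (comp _ _ _ _ _ (linF i) (gF i)).
  by rewrite residue_mulmx //= yE.
have gen j : delta_mx j 0 = foldr (fun i u => Fb i *m u) (delta_mx j0 0 : 'cV_N) (b j).
  have [y ry [wE <-]] := Fgen (b j).
  have -> : y = delta_mx j 0.
    by apply: mx_inj => l; rewrite ord1 sumdelta -wE.
  by apply/matrixP => l l'; rewrite !mxE residue_bool.
have [d dE] : exists d : 'I_N -> K, x = \sum_j d j *: g j.
  pose dd (w : L.-bseq 'I_n) := projT1 (cid2 (rsF w)).
  exists (fun j => \sum_w c w * dd w j).
  under eq_bigr do rewrite scaler_suml.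
  rewrite xE exchange_big; apply: eq_bigr => w _ /=.
  under [RHS]eq_bigr do rewrite -scalerA.
  by rewrite -scaler_sumr /dd; case: (cid2 _) => e re /= ->.
have [j2 dj2] : exists j, d j != 0.
  have [//|nd] := pselect (exists j, d j != 0); case/negP: x0; rewrite dE big1 // => j _.
  have -> : d j = 0 by apply/eqP; apply: contra_notT nd => nz; exists j.
  by rewrite scale0r.
(* Dividing by a dominant coordinate makes x primitive in the lattice, hence
   nonzero in the reduction. *)
have [j1 dj1 rd] := regular_normalize spP dj2.
have wtd j : d j != 0 -> wt (b j) = mu by apply: coord_wt dE prx j.
pose y : 'cV[K]_N := \col_j (d j / d j1).
have ry l l' : regular sp (y l l') by rewrite mxE.
have Ey i : Emx i *m y = 0.
  have z : Emx i *m \col_j d j = 0 :> 'cV_N.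
    apply: mx_inj => l; rewrite ord1 -(comp _ _ _ _ _ (linE i) (gE i)).
    under eq_bigr do rewrite mxE; rewrite -dE Ex.
    by rewrite big1 // => l' _; rewrite mxE scale0r.
  have -> : y = (d j1)^-1 *: \col_j d j by apply/matrixP => l l'; rewrite !mxE mulrC.
  by rewrite -scalemxAr z scaler0.
pose xb := map_mx (residue sp) y.
have Exb i : Eb i *m xb = 0.
  by rewrite -(residue_mulmx spP) // Ey; apply/matrixP => l l'; rewrite !mxE residue0.
have xb1 : xb j1 0 != 0 by rewrite !mxE divff // residue1 // oner_neq0.
have bj1 : forall i, count_mem i (b j1) = 0%N.
  have aD i : (A i i)%:~R = 2 :> k by rewrite A_diag.
  apply: (maximal_vector_weight (c := fun i => count_mem i (b j1)) aD rhov ct E0 (fun j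
    => ex_intro _ _ (gen j)) Exb xb1).
  - move=> i j; rewrite !mxE => nz; have dj : d j != 0.
      by apply: contraNneq nz => ->; rewrite mul0r residue0.
    by rewrite !eqxx (wtd _ dj) (wtd _ dj1).
  - move=> i; rewrite !mxE !eqxx !mulr1n -intrB.
    transitivity ((pairing i (content A (b j1)))%:~R : k).
      by rewrite bj0 /wt /content big_nil subr0 pairingD pairingN opprD opprK addrA
        subrr add0r.
    rewrite pairing_content rmorph_sum; apply: eq_bigr => j _.
    by rewrite rmorphM /= natz.
  - move=> j; rewrite -lt0n -has_count => /hasP [j' jb /eqP e].
    rewrite {j'}e in jb; apply/eqP => Fj.
    have : (delta_mx j1 0 : 'cV[k]_N) = 0.
      rewrite gen; elim: (bseqval (b j1)) jb => [|i w IH] //=.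
      by rewrite inE => /orP [/eqP <-|/IH ->]; rewrite ?Fj ?mul0mx ?mulmx0.
    by move/matrixP/(_ j1 0)/eqP; rewrite !mxE !eqxx oner_eq0.
(* All multiplicities of letters in the word b j1 are 0, so mu = lam. *)
rewrite -(wtd _ dj1) /wt (_ : content A (b j1) = 0) ?subr0 //.
apply/matrixP => z i; rewrite ord1 -[LHS]/(pairing i _) pairing_content mxE big1 // => j _.
by rewrite bj1 mul0r.
Qed.

(** Applying the E_i to x as long as the result is nonzero gives a maximal vector;
    one of its weight components has weight lam by [highest_weight_of_maximal],
    against the hypothesis on pr lam. *)
Lemma pairing_radical_trivial (T : V -> Prop) (wts : seq (weight n)) (x : V) :
  (forall v, T v -> exists c : L.-bseq 'I_n -> K, v = \sum_w c w *: Fword w) ->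
  (forall i v, T v -> T (Eop i v)) -> (forall mu v, T v -> T (pr mu v)) ->
  (forall v, \sum_(mu <- wts) pr mu v = v) ->
  (forall mu v, pr mu (pr mu v) = pr mu v) ->
  (forall w v, (L < size w)%N -> foldr Eop v w = 0) ->
  T x -> (forall w, pr lam (foldr Eop x w) = 0) -> x = 0.
Proof.
move=> Tspan TE Tpr prsum prpr Elong Tx radx; apply/eqP; apply: contraT => x0.
(* A longest E-word that does not kill x. *)
pose P j := `[< exists2 w, size w = j & foldr Eop x w != 0 >].
have exP : exists j, P j by exists 0%N; apply/asboolP; exists [::].
have maxP j : P j -> (j <= L)%N.
  move=> /asboolP [w <-]; apply: contraNT; rewrite -ltnNge => wL.
  by rewrite Elong.
case: (ex_maxnP exP maxP) => j /asboolP [w wj wx] jmax.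
have TEw u : T (foldr Eop x u) by elim: u => //= i u; apply: TE.
have Ew i : Eop i (foldr Eop x w) = 0.
  apply/eqP; apply: contraT => nz; suff: P j.+1 by move/jmax; rewrite ltnn.
  by apply/asboolP; exists (i :: w); rewrite //= wj.
have [mu prmu] : exists mu, pr mu (foldr Eop x w) != 0.
  have [//|h] := pselect (exists mu, pr mu (foldr Eop x w) != 0); case/negP: wx.
  rewrite -(prsum (foldr Eop x w)) big1 // => mu _; apply/eqP;
    apply: contra_notT h => nz; by exists mu.
have [c cE] := Tspan _ (Tpr mu _ (TEw w)).
have e : mu = lam.
  apply: (highest_weight_of_maximal cE prmu) => [i|]; last exact: prpr.
  by rewrite -prE Ew linear_fun0.
by move: prmu; rewrite e radx eqxx.
Qed.

End HighestWeight.

Local Notation "x %:F" := (tofrac x).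

Section PlaceAtOne.

(** * The place v = 1 *)

(** The place v = 1 of Q(v).  The fraction may be any one whose denominator does
    not vanish at 1. *)
Definition value_at1 (x : Qv) (c : rat) : Prop :=
  exists p q : {poly rat}, [/\ q.[1] != 0, x * q%:F = p%:F & p.[1] = c * q.[1]].

Lemma fracE (x : Qv) : exists p q : {poly rat}, q != 0 /\ x * q%:F = p%:F.
Proof.
exists (\n_(repr x)), (\d_(repr x)); split; first exact: denom_ratioP.
rewrite -{1}[x]reprK; unlock FracField.tofrac; rewrite -[LHS]FracField.pi_mul.
apply/eqmodP; rewrite /= FracField.equivfE /FracField.mulf.
by rewrite !numden_Ratio ?mulf_neq0 ?oner_neq0 ?denom_ratioP // !mulr1 mulrC. 
Qed.

(** Cancelling the common power of v - 1. *)
Lemma frac_reduced (x : Qv) : exists p q : {poly rat},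
  [/\ q != 0, x * q%:F = p%:F & (q.[1] != 0) || (p.[1] != 0)].
Proof.
have [p [q [q0 e]]] := fracE x.
have [-> | x0] := eqVneq x 0.
  by exists 0, 1; rewrite oner_neq0 mul0r tofrac0 hornerC oner_neq0.
have p0 : p != 0.
  have : p%:F != 0 :> Qv by rewrite -e mulf_eq0 (negPf x0) tofrac_eq0.
  by rewrite tofrac_eq0.
have [m [p1 /implyP /(_ p0) p11 pE]] := multiplicity_XsubC p 1.
have [k [q1 /implyP /(_ q0) q11 qE]] := multiplicity_XsubC q 1.
pose t : {poly rat} := 'X - 1%:P.
have t0 j : (t ^+ j)%:F != 0 :> Qv by rewrite tofrac_eq0 expf_neq0 // polyXsubC_eq0.
have q1n0 : q1 != 0 by apply: contraNneq q11 => ->; rewrite root0.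
have [mk|/ltnW km] := leqP m k.
  exists p1, (q1 * t ^+ (k - m)); split; last by rewrite orbC p11.
    by rewrite mulf_neq0 // expf_neq0 // polyXsubC_eq0.
  apply: (mulIf (t0 m)); rewrite -mulrA -!tofracM -pE -e qE -mulrA -exprD subnK //.
exists (p1 * t ^+ (m - k)), q1; split=> //; last by rewrite q11.
by apply: (mulIf (t0 k)); rewrite -mulrA -!tofracM -mulrA -exprD subnK // -pE -e qE.
Qed.

Lemma value_at1_place : place value_at1.
Proof.
split.
- move=> x c d [p [q [q1 e1 p1]]] [p' [q' [q1' e2 p1']]].
  have /eqP : (p * q')%:F = (p' * q)%:F.
    by rewrite !tofracM -e1 -e2; ring.
  rewrite tofrac_eq => /eqP /(congr1 (horner^~ 1)); rewrite !hornerM p1 p1' => e.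
  apply: (mulIf (mulf_neq0 q1 q1')); move: e.
  by rewrite -!mulrA [q'.[1] * _]mulrC.
- by exists 1, 1; rewrite hornerC oner_neq0 mul1r.
- move=> x c [p [q [q1 e p1]]]; exists (- p), q; split=> //.
    by rewrite mulNr e tofracN.
  by rewrite hornerN p1 mulNr.
- move=> x y c d [p [q [q1 e p1]]] [p' [q' [q1' e' p1']]].
  exists (p * q' + p' * q), (q * q'); split.
  + by rewrite hornerM mulf_neq0.
  + by rewrite tofracD !tofracM -e -e'; ring.
  + by rewrite hornerD !hornerM p1 p1'; ring.
- move=> x y c d [p [q [q1 e p1]]] [p' [q' [q1' e' p1']]].
  exists (p * p'), (q * q'); split.
  + by rewrite hornerM mulf_neq0.
  + by rewrite !tofracM -e -e'; ring.
  + by rewrite !hornerM p1 p1'; ring.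
- move=> x; have [p [q [q0 e /orP [q1|p1]]]] := frac_reduced x.
    by left; exists (p.[1] / q.[1]), p, q; split=> //; rewrite divfK.
  right; exists (q.[1] / p.[1]), q, p; split=> //; last by rewrite divfK.
  have [x0|x0] := eqVneq x 0.
    move: e; rewrite x0 mul0r => /eqP; rewrite eq_sym tofrac_eq0 => /eqP p0.
    by move: p1; rewrite p0 horner0 eqxx.
  by rewrite -e mulKf.
Qed.

Lemma value_at1_qvarX (e : int) : value_at1 (qvar ^ e) 1.
Proof.
have h (m : nat) : value_at1 (qvar ^+ m) 1.
  by exists 'X^m, 1; rewrite hornerC oner_neq0 mulr1 hornerXn expr1n mul1r -tofracXn.
have qv0 : qvar != 0 by rewrite tofrac_eq0 polyX_eq0.
case: e => m; first exact: h.
exists (1 : {poly rat}), ('X^(m.+1) : {poly rat}); split;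
  first by rewrite hornerXn expr1n oner_neq0.
  by rewrite NegzE -exprz_inv -exprnP exprVn tofracXn mulVf ?expf_neq0 // tofrac1.
by rewrite hornerC hornerXn expr1n mul1r.
Qed.

Lemma qvarX_neq1 m : (0 < m)%N -> qvar ^+ m != 1.
Proof.
move=> m0; rewrite -tofracXn -tofrac1 tofrac_eq;
  apply/eqP => /(congr1 (fun p : {poly rat} => size p)).
by rewrite size_polyXn size_poly1; case: m m0.
Qed.

(** The recursion [c + 1] = u [c] + u^(- c) between quantum integers, with s = u^c
    and t = u^(- c). *)
Lemma quantum_step (F : fieldType) (u s t : F) : u != 0 -> u - u^-1 != 0 ->
  (s * u - t * u^-1) / (u - u^-1) = u * ((s - t) / (u - u^-1)) + t.
Proof.
move=> u0 uu; apply: (mulIf uu); rewrite [in RHS]mulrDl -[u * _ * _]mulrA !divfK //.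
by field.
Qed.

(** Each step of the recursion [c + 1] = u [c] + u^(- c) adds 1 at u = 1. *)
Lemma value_at1_qint d (a : int) : (0 < d)%N -> value_at1 (qint d a) a%:~R.
Proof.
move=> d0; have spP := value_at1_place.
have qv0 : qvar != 0 by rewrite tofrac_eq0 polyX_eq0.
pose u : Qv := qvar ^+ d.
have u0 : u != 0 by rewrite expf_neq0.
have uu : u - u^-1 != 0.
  rewrite subr_eq0; apply: contra (qvarX_neq1 (m := d + d) _) => [/eqP e|];
    last by rewrite addn_gt0 d0.
  by rewrite exprD -/u {2}e mulfV.
have su (e : int) : value_at1 (u ^ e) 1.
  by rewrite /u exprnP exprz_exp; apply: value_at1_qvarX.
have rec (e : int) : qint d (e + 1) = u * qint d e + u ^ (- e).
  rewrite /qint -/u expfzDr // opprD expfzDr // expr1z [u ^ (-1)]exprN1.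
  exact: quantum_step.
have qintN (e : int) : qint d (- e) = - qint d e.
  by rewrite /qint opprK -mulNr opprB.
have nonneg (m : nat) : value_at1 (qint d m%:Z) m%:R.
  elim: m => [|m IH]; first by rewrite /qint oppr0 subrr mul0r; apply: place0.
  rewrite -[in qint _ _]addn1 PoszD rec -[m.+1]addn1 natrD -[m%:R]mul1r.
  apply: (placeD spP) => //; apply: (placeM spP) => //.
  exact: (su 1).
case: a => m; first exact: nonneg.
by rewrite NegzE qintN mulrNz; apply: (placeN spP).
Qed.

End PlaceAtOne.

Section FiniteType.
Variables (n : nat) (A : 'M[int]_n) (d : 'I_n -> nat).
Hypothesis hA : cartan_matrix_of_finite_type A d.

Let Ar : 'M[rat]_n := map_mx intr A.

(** * Finiteness of Weyl orbits *)

(** The W-invariant form in the basis of simple roots. *)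
Definition root_form (x y : 'cV[rat]_n) : rat :=
  \sum_i x i 0 * (d i)%:R * (Ar *m y) i 0.

Lemma root_formE x y : root_form x y =
  \sum_i \sum_j x i 0 * ((d i)%:Z * A i j)%:~R * y j 0.
Proof.
apply: eq_bigr => i _; rewrite mxE mulr_sumr; apply: eq_bigr => j _.
by rewrite mxE intrM; ring.
Qed.

Lemma root_formC x y : root_form x y = root_form y x.
Proof.
have [_ _ _ sym _] := hA.
rewrite !root_formE exchange_big; apply: eq_bigr => i _; apply: eq_bigr => j _.
by rewrite sym; ring.
Qed.

Lemma root_formDl x y z : root_form (x + y) z = root_form x z + root_form y z.
Proof. by rewrite -big_split; apply: eq_bigr => i _; rewrite mxE !mulrDl. Qed.

Lemma root_formZl c x z : root_form (c *: x) z = c * root_form x z.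
Proof. by rewrite mulr_sumr; apply: eq_bigr => i _; rewrite mxE !mulrA. Qed.

Lemma root_form_gt0 x : x != 0 -> 0 < root_form x x.
Proof.
move=> x0; rewrite root_formE; have [_ _ _ _ pos] := hA.
apply: (pos (fun i => x i 0)).
have [//|h] := pselect (exists i, x i 0 != 0); case/negP: x0.
apply/eqP/matrixP => i j; rewrite ord1 mxE; apply/eqP.
by apply: contra_notT h => nz; exists i.
Qed.

Lemma root_form_ge0 x : 0 <= root_form x x.
Proof.
have [->|/root_form_gt0/ltW //] := eqVneq x 0.
by rewrite -(scale0r 0) root_formZl mul0r.
Qed.

Lemma root_form_delta i y : root_form (delta_mx i 0) y = (d i)%:R * (Ar *m y) i 0.
Proof.
rewrite /root_form (bigD1 i) //= [X in X * _ * _]mxE !eqxx mul1r big1 ?addr0 // => j ji.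
by rewrite mxE (negPf ji) !mul0r.
Qed.

Lemma cartan_unit : Ar \in unitmx.
Proof.
rewrite -unitmx_tr -row_free_unit -kermx_eq0; apply/rowV0P => u /sub_kermxP uA.
have Au : Ar *m u^T = 0 by rewrite -[LHS]trmxK trmx_mul trmxK uA trmx0.
apply/eqP; rewrite -trmx_eq0; apply: contraT => /root_form_gt0.
by rewrite /root_form big1 ?ltxx // => i _; rewrite Au [X in _ * X]mxE mulr0.
Qed.

(** The sum of the fundamental coweights. *)
Lemma exists_rho_check : exists r : 'I_n -> rat, forall j, \sum_i r i * (A i j)%:~R = 1.
Proof.
pose v : 'rV[rat]_n := const_mx 1 *m invmx Ar; exists (v 0) => j.
have: (v *m Ar) 0 j = 1 by rewrite mulmxKV ?cartan_unit // mxE.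
by move=> e; rewrite -[RHS]e [RHS]mxE; apply: eq_bigr => i _; rewrite [Ar i j]mxE.
Qed.

Definition root_coords (lam : weight n) : 'cV[rat]_n :=
  invmx Ar *m \col_i (pairing i lam)%:~R.

Definition wnorm (lam : weight n) : rat := root_form (root_coords lam) (root_coords lam).

Lemma cartan_root_coords lam i : (Ar *m root_coords lam) i 0 = (pairing i lam)%:~R.
Proof. by rewrite mulKVmx ?cartan_unit // mxE. Qed.

Lemma wnorm_shift lam i c :
  root_form (root_coords lam - c *: delta_mx i 0) (root_coords lam - c *: delta_mx i 0) =
  wnorm lam - 2 * c * (d i)%:R * (pairing i lam)%:~R + 2 * c ^+ 2 * (d i)%:R.
Proof.
have [Aii _ _ _ _] := hA.
have Add : root_form (delta_mx i 0) (delta_mx i 0) = 2 * (d i)%:R.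
  rewrite root_form_delta -colE mxE [X in _ * X]mxE Aii mulrC //.
have Adl : root_form (delta_mx i 0) (root_coords lam) = (d i)%:R * (pairing i lam)%:~R.
  by rewrite root_form_delta cartan_root_coords.
rewrite -scaleNr root_formDl root_formZl ![root_form _ (_ + _)]root_formC.
rewrite !root_formDl !root_formZl Add [root_form _ (delta_mx i 0)]root_formC Adl.
by rewrite /wnorm; ring.
Qed.

Lemma pairing_reflection i j lam :
  pairing j (simple_reflection A i lam) = pairing j lam - pairing i lam * A j i.
Proof.
have pMn (x : weight n) m : pairing j (x *+ m) = pairing j x *+ m.
  elim: m => [|m IH]; first by rewrite !mulr0n /pairing mxE.
  by rewrite !mulrS pairingD IH.
rewrite /simple_reflection pairingD pairingN -[A j i]pairing_root; congr (_ - _).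
case: (pairing i lam) => m; first by rewrite -pmulrn pMn -mulr_natl natz.
by rewrite NegzE mulrNz pairingN -pmulrn pMn mulNr -mulr_natl natz.
Qed.

Lemma wnorm_reflection i lam : wnorm (simple_reflection A i lam) = wnorm lam.
Proof.
have e : root_coords (simple_reflection A i lam) =
    root_coords lam - (pairing i lam)%:~R *: delta_mx i 0.
  apply: (can_inj (mulKmx cartan_unit)); rewrite mulmxBr -scalemxAr -colE.
  apply/matrixP => j z; rewrite ord1 cartan_root_coords mxE cartan_root_coords.
  by rewrite !mxE pairing_reflection intrB intrM.
by rewrite /wnorm e wnorm_shift -/(wnorm lam); ring.
Qed.

(** The form is nonnegative at lam - (lam_i / 2) alpha_i. *)
Lemma wnorm_bound lam i : (pairing i lam)%:~R ^+ 2 <= 2 * wnorm lam.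
Proof.
have [_ _ dpos _ _] := hA.
have := root_form_ge0 (root_coords lam - ((pairing i lam)%:~R / 2) *: delta_mx i 0).
rewrite wnorm_shift; have := root_form_ge0 (root_coords lam); rewrite -/(wnorm lam).
have : 1 <= (d i)%:R :> rat by rewrite ler1n; case/andP: (dpos i).
move: (wnorm lam) (_%:~R : rat) (_%:R : rat) => q p e; nra.
Qed.

Lemma bounded_weights_finite (M : nat) :
  finite_set [set lam : weight n | forall i, `|pairing i lam| <= M%:Z]%classic.
Proof.
pose f (g : {ffun 'I_n -> 'I_(2 * M).+1}) : weight n := \row_i ((g i)%:Z - M%:Z).
apply: (@sub_finite_set _ _ (range f)); last first.
  apply: finite_image; exact: finite_finset.
move=> lam /= h; exists [ffun i => inord (absz (pairing i lam + M%:Z))] => //.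
apply/matrixP => z i; rewrite ord1 !mxE ffunE inordK; last first.
  by have := h i; lia.
have := h i; rewrite /pairing; move: (lam 0 i) => t hz; rewrite gez0_abs;
  first by rewrite addrK.
by move: hz; rewrite ler_norml => /andP [hz _]; rewrite -subr_ge0 opprK in hz.
Qed.

(** Reflections preserve the norm, which bounds all the integers
    <alpha_i^vee, lam>. *)
Lemma weyl_orbits_finite (pi : set (weight n)) :
  finite_set pi -> finite_set (weyl_orbits A pi).
Proof.
move=> fpi.
have wE w mu : wnorm (weyl_action A w mu) = wnorm mu.
  by elim: w => //= i w IH; rewrite wnorm_reflection.
have bnd mu : exists M : nat, 2 * wnorm mu <= M%:R.
  exists (Num.bound (2 * wnorm mu)); apply: ltW; apply: archi_boundP.
  by rewrite mulr_ge0 // root_form_ge0.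
have /choice [M MP] := bnd.
apply: (@sub_finite_set _ _ (\bigcup_(mu in pi)
   [set lam : weight n | forall i, `|pairing i lam| <= (M mu)%:Z])%classic); last first.
  by apply: bigcup_finite => // mu _; apply: bounded_weights_finite.
move=> lam /= [w [mu [pimu ->]]]; exists mu => // i /=.
have := wnorm_bound (weyl_action A w mu) i; rewrite wE => /le_trans /(_ (MP mu)).
rewrite -rmorphXn /= -[(M mu)%:R]/((M mu)%:Z%:~R) ler_int.
by move: (pairing i _) => z; nia.
Qed.

End FiniteType.

Section FreeAlgebra.
Variables (K : comNzRingType) (I : choiceType).

(** * Finite dimensional and semisimple algebras *)

Lemma freealg_ind (P : freealg K I -> Prop) :
  P 0 -> (forall a x y, P x -> P y -> P (a *: x + y)) -> P 1 ->
  (forall i x, P x -> P (freegen K i * x)) -> forall x, P x.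
Proof.
move=> P0 PL P1 Pm x.
have PZ a y : P y -> P (a *: y) by move=> Py; rewrite -[_ *: _]addr0; apply: PL.
have Pw (s : seq I) : P << FMonom s >>.
  elim: s => [|i s IH].
    by have -> : << FMonom [::] >> = 1 :> freealg K I by apply/malgP => m;
      rewrite mcoeff1 mcoeffU1 eq_sym /mone /= fmoneE eq_sym.
  have -> : << FMonom (i :: s) >> = freegen K i * << FMonom s >> :> freealg K I.
    rewrite /freegen malgM_def fgmulUU mulr1; congr (<< _ >>).
    by rewrite /mmul /= fmmulE fmuE.
  exact: Pm.
rewrite [x]monalgE; apply: big_ind => // [y z Py Pz|m _].
  by rewrite -[y]scale1r; apply: PL.
have -> : << x@_m *g m >> = x@_m *: << m >> :> freealg K I.
  by apply/malgP => m'; rewrite mcoeffZ !mcoeffU mulr_natr.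
by apply: PZ; case: m.
Qed.

End FreeAlgebra.

Section FiniteDim.
Variables (K : fieldType) (V : lmodType K).

Lemma place_id : place (@eq K).
Proof.
split=> // [x c d -> //|x c ->|x y c d -> ->|x y c d -> ->|x] //.
by left; exists x.
Qed.

(** [regular_basis] for the identity place extracts a basis from a spanning family. *)
Lemma finite_dimensional_spanned k (g : 'I_k -> V) :
  (forall x, exists c : 'I_k -> K, x = \sum_i c i *: g i) -> finite_dimensional V.
Proof.
move=> gP; have [N [b [bspan bind]]] := regular_basis place_id g.
exists N; constructor.
have sp (x : V) : exists c : 'rV[K]_N, x = \sum_j c 0 j *: g (b j).
  have [c ->] := gP x.
  have /choice [e eP] : forall i, exists e : 'I_N -> K, g i = \sum_j e j *: g (b j).
    by move=> i; have [e _ ->] := bspan i; exists e.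
  exists (\row_j \sum_i c i * e i j).
  under eq_bigr do rewrite eP scaler_sumr.
  rewrite exchange_big; apply: eq_bigr => j _ /=; rewrite mxE scaler_suml.
  by apply: eq_bigr => i _; rewrite scalerA.
have uniq (c c' : 'rV[K]_N) :
    \sum_j c 0 j *: g (b j) = \sum_j c' 0 j *: g (b j) -> c = c'.
  move=> e; apply/rowP => j; apply/eqP; rewrite -subr_eq0; apply/eqP.
  apply: (bind (fun j => c 0 j - c' 0 j)).
  under eq_bigr do rewrite scalerBl.
  by rewrite sumrB e subrr.
pose f x := projT1 (cid (sp x)).
have fP x : x = \sum_j f x 0 j *: g (b j) by rewrite /f; case: cid.
exists f.
  move=> a x y; apply: uniq; rewrite -fP {1}[x]fP {1}[y]fP scaler_sumr -big_split.
  by apply: eq_bigr => j _ /=; rewrite !mxE scalerDl scalerA.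
exists (fun c : 'rV_N => \sum_j c 0 j *: g (b j)) => [x|c]; first by rewrite -fP.
by apply: uniq; rewrite -fP.
Qed.

End FiniteDim.

Section Socle.
Variable R : pzRingType.
Implicit Types x y z : R.

Definition principal (y : R) : {pred R^o} := fun z => `[< exists a : R, z = a * y >].

Lemma principalP y z : reflect (exists a : R, z = a * y) (z \in principal y).
Proof. exact: asboolP. Qed.

Lemma principal_left_ideal y : left_ideal (principal y).
Proof.
split=> [|a u v]; first by apply/principalP; exists 0; rewrite mul0r.
move=> /principalP [b ->] /principalP [c ->]; apply/principalP; exists (a * b + c).
by rewrite mulrDl -mulrA.
Qed.

Lemma left_idealMl (L : {pred R^o}) a x : left_ideal L -> x \in L -> a * x \in L.
Proof. by move=> [L0 Lc] xL; rewrite -[a * x]addr0; apply: (Lc a x 0). Qed.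

(** Sums of elements generating simple left ideals: the left socle, since a simple
    left ideal is generated by each of its nonzero elements. *)
Definition in_socle x : Prop := exists s : seq R,
  x = \sum_(y <- s) y /\ forall y, y \in s -> simple_left_ideal (principal y).

Lemma in_socle0 : in_socle 0.
Proof. by exists [::]; rewrite big_nil. Qed.

Lemma in_socleD x y : in_socle x -> in_socle y -> in_socle (x + y).
Proof.
move=> [s [-> hs]] [t [-> ht]]; exists (s ++ t); rewrite big_cat; split=> // w.
by rewrite mem_cat => /orP [/hs|/ht].
Qed.

(** If 1 = sum_i y_i with S y_i simple and a minimal number of terms, the sum of
    the S y_i is direct: a nontrivial relation would put some S y_i into the sum of
    the others, by simplicity. *)
Lemma semisimple_of_socle : in_socle 1 -> semisimple_ring R.
Proof.
move=> [s [s1 hs]]; pose y (i : 'I_(size s)) : R := nth 0 s i.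
have hy i : simple_left_ideal (principal (y i)) by apply: hs; rewrite mem_nth.
pose Q (B : {set 'I_(size s)}) := `[< exists a : 'I_(size s) -> R, 1 = \sum_(i in B) a
  i * y i >].
have QT : Q finset.setT.
  apply/asboolP; exists (fun=> 1); rewrite [LHS]s1 (big_nth 0) big_mkord.
  by apply: eq_big => [i|i _]; rewrite ?inE ?mul1r.
have [B /asboolP [a aE] Bmin] := arg_minnP (fun B : {set 'I_(size s)} => #|B|) QT.
have ind (v : 'I_(size s) -> R) : (forall i, i \in B -> v i \in principal (y i)) ->
    \sum_(i in B) v i = 0 -> forall i, i \in B -> v i = 0.
  move=> vy v0 i iB; apply/eqP; apply: contraT => vi.
  have [_ _ /(_ (principal (v i)) (principal_left_ideal _))] := hy i.
  have sub : {subset principal (v i) <= principal (y i)}.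
    move=> z /principalP [b ->]; apply: left_idealMl; first exact: principal_left_ideal.
    exact: vy.
  have vvi : v i \in principal (v i) by apply/principalP; exists 1; rewrite mul1r.
  have nz : exists2 x : R^o, x \in principal (v i) & x != 0 by exists (v i).
  move=> /(_ sub nz (y i)) h.
  have /principalP [c yc] : y i \in principal (v i).
    by apply: h; apply/principalP; exists 1; rewrite mul1r.
  have ex j : exists b, j \in B -> v j = b * y j.
    have [jB|] := boolP (j \in B); last by exists 0.
    by have /principalP [b ->] := vy j jB; exists b.
  have /choice [b bE] := ex.
  have: Q (B :\ i).
    apply/asboolP; exists (fun j => a j - a i * c * b j).
    rewrite [LHS]aE (bigD1 i) //= yc.
    have -> : v i = - \sum_(j in B :\ i) v j.
      apply/eqP; rewrite -addr_eq0 -[X in _ == X]v0 [X in _ == X](bigD1 i) //=.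
      by apply/eqP; congr (_ + _); apply: eq_bigl => j; rewrite !inE andbC.
    rewrite !mulrN mulrA mulr_sumr -sumrN.
    rewrite [X in _ + X](_ : _ = \sum_(j in B :\ i) a j * y j); last first.
      by apply: eq_bigl => j; rewrite !inE andbC.
    rewrite -big_split; apply: eq_bigr => j /=; rewrite !inE => /andP [_ jB].
    by rewrite bE // mulrBl addrC !mulrA.
  by move=> /Bmin; rewrite leqNgt (cardsD1 i B) iB ltnS leqnn.
exists #|B|, (fun j => principal (y (enum_val j))); split=> [j|x]; first exact: hy.
exists [ffun j => (x * a (enum_val j)) * y (enum_val j) : R^o]; split.
  split=> [j|]; first by rewrite ffunE; apply/principalP; exists (x * a (enum_val j)).
  rewrite -[LHS]mulr1 aE mulr_sumr big_enum_val /=.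
  by apply: eq_bigr => j _; rewrite ffunE mulrA.
move=> u [uL xE]; apply/ffunP => j; rewrite ffunE; apply/eqP; rewrite -subr_eq0; apply/eqP.
have jB := enum_valP j.
pose v i := x * a i * y i - u (enum_rank_in jB i).
have := ind v; rewrite /v => /(_ _ _ _ jB); rewrite enum_valK_in; apply.
  move=> i iB; have [_ Lc] := principal_left_ideal (y i).
  rewrite addrC -mulN1r; apply: Lc.
    by have := uL (enum_rank_in jB i); rewrite enum_rankK_in.
  by apply/principalP; exists (x * a i).
rewrite sumrB big_enum_val /= [X in _ - X]big_enum_val /=.
rewrite [X in _ - X](_ : _ = x); last first.
  by rewrite xE; apply: eq_bigr => i _; rewrite enum_valK_in.
rewrite -(big_enum_val (fun i => x * a i * y i)) /=.
under eq_bigr do rewrite -mulrA.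
by rewrite -mulr_sumr -aE mulr1 subrr.
Qed.

End Socle.

Lemma seq_has_max (T : eqType) (R : realFieldType) (f : T -> R) (s : seq T) x0 :
  x0 \in s -> exists2 x, x \in s & forall y, y \in s -> f y <= f x.
Proof.
elim: s x0 => // x s IH x0 _; case: s IH => [_|y s /(_ y (mem_head _ _))].
  by exists x; rewrite ?mem_head // => y; rewrite inE => /eqP ->.
move=> [z zs zmax]; have [fz|fz] := leP (f x) (f z).
  by exists z => [|t]; rewrite in_cons ?zs ?orbT // => /orP [/eqP -> //|/zmax].
exists x; rewrite ?mem_head // => t; rewrite in_cons => /orP [/eqP -> //|/zmax].
by move=> /le_trans; apply; apply: ltW.
Qed.

Section WeightAlgebra.
Variables (K : fieldType) (S : algType K).
Variables (n : nat) (A : 'M[int]_n) (q : 'I_n -> int -> K) (wts : seq (weight n)).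
Variables (sE sF : 'I_n -> S) (s1 : weight n -> S).

(** * Algebras with weight idempotents *)

(** The relations of S(pi) between weight idempotents and Chevalley generators, with
    s1 extended by 0 outside the list of weights. *)
Record weight_algebra : Prop := WeightAlgebra {
  wa_out : forall lam, lam \notin wts -> s1 lam = 0;
  wa_1M : forall lam mu, s1 lam * s1 mu = s1 lam *+ (lam == mu);
  wa_sum : \sum_(lam <- wts) s1 lam = 1;
  wa_E1 : forall i lam, sE i * s1 lam = s1 (lam + simple_root A i) * sE i;
  wa_F1 : forall i lam, sF i * s1 lam = s1 (lam - simple_root A i) * sF i;
  wa_EF : forall i j, sE i * sF j = sF j * sE i +
    (\sum_(lam <- wts) q i (pairing i lam) *: s1 lam) *+ (i == j);
  wa_ind : forall P : S -> Prop, subspace P -> P 1 ->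
    (forall i x, P x -> P (sE i * x)) -> (forall i x, P x -> P (sF i * x)) ->
    (forall lam x, P x -> P (s1 lam * x)) -> forall x, P x
}.

Variables (k : realFieldType) (sp : K -> k -> Prop) (r : 'I_n -> k).
Hypothesis spP : place sp.
Hypothesis sp_q : forall i c, sp (q i c) c%:~R.
Hypothesis A_diag : forall i, A i i = 2.
Hypothesis rhov : forall j, \sum_i r i * (A i j)%:~R = 1.
Hypothesis wa : weight_algebra.
Hypothesis wts_uniq : uniq wts.
Variable Lb : nat.
Hypothesis height_gap : forall lam mu, lam \in wts -> mu \in wts ->
  height r lam - height r mu <= Lb%:R.

Definition Fprod (w : seq 'I_n) : S := \prod_(i <- w) sF i.
Definition Eprod (w : seq 'I_n) : S := \prod_(i <- w) sE i.

Lemma Fprod_cons i w : Fprod (i :: w) = sF i * Fprod w. Proof. exact: big_cons. Qed.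
Lemma Eprod_cons i w : Eprod (i :: w) = sE i * Eprod w. Proof. exact: big_cons. Qed.
Lemma Fprod_nil : Fprod [::] = 1. Proof. exact: big_nil. Qed.
Lemma Eprod_nil : Eprod [::] = 1. Proof. exact: big_nil. Qed.

Lemma s1_Fprod lam w : s1 lam * Fprod w = Fprod w * s1 (lam + content A w).
Proof.
elim: w lam => [|i w IH] lam; first by rewrite Fprod_nil mulr1 mul1r /content big_nil addr0.
rewrite Fprod_cons content_cons -mulrA addrA -IH !mulrA; congr (_ * _).
by rewrite (wa_F1 wa) addrK.
Qed.

Lemma s1_Eprod lam w : s1 lam * Eprod w = Eprod w * s1 (lam - content A w).
Proof.
elim: w lam => [|i w IH] lam; first by rewrite Eprod_nil mulr1 mul1r /content big_nil subr0.
rewrite Eprod_cons content_cons -mulrA opprD addrA -IH !mulrA; congr (_ * _).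
by rewrite (wa_E1 wa) subrK.
Qed.

Inductive triangular : S -> Prop :=
| Triangular_gen w lam w' : triangular (Fprod w * s1 lam * Eprod w')
| Triangular0 : triangular 0
| TriangularL (c : K) x y of triangular x & triangular y : triangular (c *: x + y).

Lemma triangular_subspace : subspace triangular.
Proof. by split=> [|c x y]; [exact: Triangular0|exact: TriangularL]. Qed.

Lemma triangular_mull u : (forall w lam w', triangular (u * (Fprod w * s1 lam * Eprod
  w'))) ->
  forall x, triangular x -> triangular (u * x).
Proof.
move=> h x; elim=> {x} [//||c x y _ IHx _ IHy]; first by rewrite mulr0; exact: Triangular0.
by rewrite mulrDr -scalerAr; apply: TriangularL.
Qed.

Lemma triangularF j x : triangular x -> triangular (sF j * x).
Proof.
by apply: triangular_mull => w lam w'; rewrite !mulrA -Fprod_cons; apply: Triangular_gen.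
Qed.

Lemma triangular1 mu x : triangular x -> triangular (s1 mu * x).
Proof.
apply: triangular_mull => w lam w'; rewrite !mulrA s1_Fprod -[_ * s1 lam]mulrA (wa_1M wa).
case: eqP => _; rewrite ?mulr0n ?mulr0 ?mul0r; last exact: Triangular0.
exact: Triangular_gen.
Qed.

Lemma triangularE i x : triangular x -> triangular (sE i * x).
Proof.
have st := triangular_subspace.
apply: triangular_mull => w lam w'; elim: w => [|j w IH].
  rewrite Fprod_nil mul1r mulrA (wa_E1 wa) -mulrA -Eprod_cons -[X in X * _]mul1r -Fprod_nil.
  exact: Triangular_gen.
rewrite Fprod_cons -!mulrA mulrA (wa_EF wa) mulrDl; apply: subspaceD => //.
  by rewrite -mulrA; apply: triangularF; rewrite !mulrA in IH *.
rewrite mulrb; case: eqP => _; last by rewrite mul0r; exact: Triangular0.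
rewrite mulr_suml; apply: subspace_sum => // mu _; rewrite -scalerAl.
by apply: subspaceZ => //; apply: triangular1; rewrite mulrA; apply: Triangular_gen.
Qed.

(** The span of the triangular products contains 1 and is stable under left
    multiplication by the generators; E_i moves through the F-letters at the cost
    of weight idempotents. *)
Lemma triangular_decomposition x : triangular x.
Proof.
have st := triangular_subspace.
apply: (wa_ind wa) => //; [|exact: triangularE|exact: triangularF|exact: triangular1].
rewrite -(wa_sum wa); apply: subspace_sum => // lam _.
by rewrite -[s1 lam]mul1r -[_ * _]mulr1 -{1}Fprod_nil -Eprod_nil; apply: Triangular_gen.
Qed.

(** A word of length l connects two weights whose heights differ by l. *)
Lemma long_words_vanish w lam : (Lb < size w)%N ->
  Fprod w * s1 lam = 0 /\ s1 lam * Eprod w = 0.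
Proof.
rewrite ltnNge => wL.
have key : s1 lam = 0 \/ s1 (lam - content A w) = 0.
  have [Wl|/(wa_out wa)] := boolP (lam \in wts); last by left.
  have [Wc|/(wa_out wa)] := boolP (lam - content A w \in wts); last by right.
  case/negP: wL; rewrite -(ler_nat k) -(height_content rhov).
  by have := height_gap Wl Wc; rewrite heightB opprB addrC subrK.
split; last by rewrite s1_Eprod; case: key => e;
  [rewrite -s1_Eprod e mul0r|rewrite e mulr0].
have := s1_Fprod (lam - content A w) w; rewrite subrK => <-.
case: key => e; last by rewrite e mul0r.
by rewrite s1_Fprod subrK e mulr0.
Qed.

Lemma weight_algebra_finite_dimensional : finite_dimensional S.
Proof.
pose I : finType := ('I_(size wts) * (Lb.-bseq 'I_n * Lb.-bseq 'I_n))%type.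
pose g (t : I) : S := Fprod t.2.1 * s1 (nth 0 wts t.1) * Eprod t.2.2.
apply: (@finite_dimensional_spanned _ S #|I| (fun k => g (enum_val k))) => x.
suff [c ->] : exists c : I -> K, x = \sum_t c t *: g t.
  by exists (fun k => c (enum_val k)); rewrite (reindex _ (onW_bij _ (enum_val_bij I))).
elim: (triangular_decomposition x) => {x} [w lam w'||c x y _ [cx ->] _ [cy ->]].
- have Z : Fprod w * s1 lam * Eprod w' = 0 -> exists c : I -> K, Fprod w * s1 lam *
  Eprod w' = \sum_t c t *: g t.
    by move=> ->; exists (fun=> 0); rewrite big1 // => t _; rewrite scale0r.
  have [lw|/(wa_out wa) e] := boolP (lam \in wts); last by apply: Z; rewrite e mulr0 mul0r.
  have [wL|wL] := leqP (size w) Lb; last by apply: Z;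
    rewrite (long_words_vanish lam wL).1 mul0r.
  have [wL'|wL'] := leqP (size w') Lb; last by apply: Z;
    rewrite -mulrA (long_words_vanish lam wL').2 mulr0.
  have il : (index lam wts < size wts)%N by rewrite index_mem.
  pose t0 : I := (Ordinal il, (Bseq wL, Bseq wL')).
  exists (fun t => (t == t0)%:R); rewrite (bigD1 t0) //= eqxx scale1r big1 ?addr0.
    by rewrite /g /= nth_index.
  by move=> t /negPf ->; rewrite scale0r.
- by exists (fun=> 0); rewrite big1 // => t _; rewrite scale0r.
- exists (fun t => c * cx t + cy t); rewrite scaler_sumr -big_split.
  by apply: eq_bigr => t _ /=; rewrite scalerDl scalerA.
Qed.

Lemma sum_s1_left i nu x : s1 nu * x = x ->
  (\sum_(mu <- wts) q i (pairing i mu) *: s1 mu) * x = q i (pairing i nu) *: x.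
Proof.
move=> nx; rewrite mulr_suml.
have e mu : (q i (pairing i mu) *: s1 mu) * x = (q i (pairing i nu) *: x) *+ (mu == nu).
  rewrite -{1}nx mulrA -scalerAl (wa_1M wa) !mulrb; case: eqP => [->|_].
    by rewrite -scalerAl nx.
  by rewrite scaler0 mul0r.
rewrite (eq_bigr _ (fun mu _ => e mu)).
have [nw|nw] := boolP (nu \in wts).
  rewrite (bigD1_seq nu) //= eqxx mulr1n big1 ?addr0 // => mu /negPf ->.
  by rewrite mulr0n.
have x0 : x = 0 by rewrite -nx (wa_out wa nw) mul0r.
by rewrite x0 scaler0 big1 // => mu _; rewrite mul0rn.
Qed.

Lemma sum_s1_right i nu x : x * s1 nu = x ->
  x * (\sum_(mu <- wts) q i (pairing i mu) *: s1 mu) = q i (pairing i nu) *: x.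
Proof.
move=> nx; rewrite mulr_sumr.
have e mu : x * (q i (pairing i mu) *: s1 mu) = (q i (pairing i nu) *: x) *+ (mu == nu).
  rewrite -{1}nx -mulrA -scalerAr (wa_1M wa) !mulrb eq_sym; case: eqP => [->|_].
    by rewrite -scalerAr nx.
  by rewrite scaler0 mulr0.
rewrite (eq_bigr _ (fun mu _ => e mu)).
have [nw|nw] := boolP (nu \in wts).
  rewrite (bigD1_seq nu) //= eqxx mulr1n big1 ?addr0 // => mu /negPf ->.
  by rewrite mulr0n.
have x0 : x = 0 by rewrite -nx (wa_out wa nw) mulr0.
by rewrite x0 scaler0 big1 // => mu _; rewrite mul0rn.
Qed.

Lemma Eprod_long w : (Lb < size w)%N -> Eprod w = 0.
Proof.
move=> wL; rewrite -[Eprod w]mul1r -(wa_sum wa) mulr_suml big1 // => lam _.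
by case: (long_words_vanish lam wL).
Qed.

Lemma Fprod_long w : (Lb < size w)%N -> Fprod w = 0.
Proof.
move=> wL; rewrite -[Fprod w]mulr1 -(wa_sum wa) mulr_sumr big1 // => lam _.
by case: (long_words_vanish lam wL).
Qed.

(** The idempotent e is 1_lam in the block of z, and lam is maximal there. *)
Section HighestIdempotent.
Variables (z : S) (lam : weight n).
Hypothesis zz : z * z = z.
Hypothesis zC : forall x, x * z = z * x.
Hypothesis z_max : forall i, s1 (lam + simple_root A i) * z = 0.
Let e := s1 lam * z.
Hypothesis e_neq0 : e != 0.

Lemma s1lam_idem : s1 lam * s1 lam = s1 lam.
Proof. by rewrite (wa_1M wa) eqxx. Qed.

Lemma ee : e * e = e.
Proof. by rewrite /e mulrA -[s1 lam * z * s1 lam]mulrA -zC mulrA s1lam_idem -mulrA zz. Qed.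

Lemma sEe i : sE i * e = 0.
Proof. by rewrite /e mulrA (wa_E1 wa) -mulrA zC mulrA z_max mul0r. Qed.

Lemma esF i : e * sF i = 0.
Proof.
rewrite /e -mulrA -zC mulrA.
have := wa_F1 wa i (lam + simple_root A i); rewrite addrK => <-.
by rewrite -mulrA z_max mulr0.
Qed.

Lemma s1e mu : s1 mu * e = e *+ (mu == lam).
Proof. by rewrite /e mulrA (wa_1M wa) !mulrb; case: eqP => [->|_]; rewrite ?mul0r. Qed.

Lemma es1 mu : e * s1 mu = e *+ (mu == lam).
Proof.
rewrite /e -mulrA -zC mulrA (wa_1M wa) !mulrb eq_sym; case: (mu =P lam) => _ //.
by rewrite mul0r.
Qed.

Lemma ez : e * z = e. Proof. by rewrite /e -mulrA zz. Qed.

Lemma Eprod_e w : Eprod w * e = if w is [::] then e else 0.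
Proof.
elim: w => [|i w IH]; first by rewrite Eprod_nil mul1r.
rewrite Eprod_cons -mulrA IH.
by case: w {IH} => [|j w]; rewrite ?sEe ?mulr0.
Qed.

Lemma e_Fprod w : e * Fprod w = if w is [::] then e else 0.
Proof.
case: w => [|i w]; first by rewrite Fprod_nil mulr1.
by rewrite Fprod_cons mulrA esF mul0r.
Qed.

(** In e F.. 1_mu E.. e only the term with empty words survives. *)
Lemma corner_scalar x : exists c, e * x * e = c *: e.
Proof.
elim: (triangular_decomposition x) => {x} [w mu w'||c x y _ [cx hx] _ [cy hy]].
- have -> : e * (Fprod w * s1 mu * Eprod w') * e = (e * Fprod w) * s1 mu * (Eprod w' * e).
    by rewrite !mulrA.
  rewrite e_Fprod Eprod_e; case: w => [|i w]; last by exists 0; rewrite !mul0r scale0r.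
  case: w' => [|i w']; last by exists 0; rewrite mulr0 scale0r.
  by exists (mu == lam)%:R; rewrite es1 mulrnAl ee scaler_nat.
- by exists 0; rewrite mulr0 mul0r scale0r.
- by exists (c * cx + cy); rewrite mulrDr mulrDl -scalerAr -scalerAl hx hy scalerA scalerDl.
Qed.

Lemma left_span x : exists c : Lb.-bseq 'I_n -> K, x * e = \sum_w c w *: (Fprod w * e).
Proof.
elim: (triangular_decomposition x) => {x} [w mu w'||c x y _ [cx hx] _ [cy hy]].
- have Z x : x = 0 -> exists c : Lb.-bseq 'I_n -> K, x = \sum_w c w *: (Fprod w * e).
    by move=> ->; exists (fun=> 0); rewrite big1 // => u _; rewrite scale0r.
  rewrite -mulrA Eprod_e; case: w' => [|i w']; last by apply: Z; rewrite mulr0.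
  rewrite -mulrA s1e mulrb; case: eqP => _; last by apply: Z; rewrite mulr0.
  have [wL|wL] := leqP (size w) Lb; last by apply: Z; rewrite Fprod_long // mul0r.
  exists (fun u => (u == Bseq wL)%:R); rewrite (bigD1 (Bseq wL)) //= eqxx scale1r.
  by rewrite big1 ?addr0 // => u /negPf ->; rewrite scale0r.
- by exists (fun=> 0); rewrite mul0r big1 // => w _; rewrite scale0r.
- exists (fun w => c * cx w + cy w); rewrite mulrDl -scalerAl hx hy scaler_sumr -big_split.
  by apply: eq_bigr => w _ /=; rewrite scalerDl scalerA.
Qed.

Lemma right_span x : exists c : Lb.-bseq 'I_n -> K, e * x = \sum_w c w *: (e * Eprod
  (rev w)).
Proof.
elim: (triangular_decomposition x) => {x} [w mu w'||c x y _ [cx hx] _ [cy hy]].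
- have Z x : x = 0 -> exists c : Lb.-bseq 'I_n -> K, x = \sum_w c w *: (e * Eprod (rev w)).
    by move=> ->; exists (fun=> 0); rewrite big1 // => u _; rewrite scale0r.
  rewrite !mulrA [e * _]e_Fprod; case: w => [|i w]; last by apply: Z; rewrite !mul0r.
  rewrite es1 mulrb; case: eqP => _; last by apply: Z; rewrite mul0r.
  have [wL|wL] := leqP (size (rev w')) Lb; last first.
    by apply: Z; rewrite size_rev in wL; rewrite Eprod_long // mulr0.
  exists (fun u => (u == Bseq wL)%:R); rewrite (bigD1 (Bseq wL)) //= eqxx scale1r revK.
  by rewrite big1 ?addr0 // => u /negPf ->; rewrite scale0r.
- by exists (fun=> 0); rewrite mulr0 big1 // => w _; rewrite scale0r.
- exists (fun w => c * cx w + cy w); rewrite mulrDr -scalerAr hx hy scaler_sumr -big_split.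
  by apply: eq_bigr => w _ /=; rewrite scalerDl scalerA.
Qed.

Lemma left_Fword w : Fword (fun i u => sF i * u) e w = Fprod w * e.
Proof.
by elim: w => [|i w IH]; rewrite ?Fprod_nil ?mul1r // Fprod_cons -mulrA -IH.
Qed.

Lemma right_Fword w : Fword (fun i u => u * sE i) e w = e * Eprod (rev w).
Proof.
elim: w => [|i w IH]; first by rewrite Eprod_nil mulr1.
rewrite /= rev_cons -cats1 /Eprod big_cat /= big_seq1 mulrA; congr (_ * _).
exact: IH.
Qed.

(** S e is a highest weight module for left multiplication by the E_i and F_i. *)
Lemma left_nondeg x : x * e = x -> (forall y, e * y * x = 0) -> x = 0.
Proof.
move=> xe radx.
apply: (@pairing_radical_trivial _ _ _ spP _ _ _ _ A_diag rhov sp_q S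
  (fun i u => sE i * u) (fun i u => sF i * u) (fun mu u => s1 mu * u) e lam Lb
  _ _ _ _ _ _ _ _ _ _ (fun v => v * e = v) wts) => //.
- by move=> i a u v; rewrite mulrDr -scalerAr.
- by move=> i a u v; rewrite mulrDr -scalerAr.
- by move=> i a u v; rewrite mulrDr -scalerAr.
- by move=> mu i v; rewrite !mulrA (wa_E1 wa).
- by move=> mu i v; rewrite !mulrA (wa_F1 wa).
- exact: s1e.
- exact: sEe.
- move=> i j w; rewrite mulrA (wa_EF wa) mulrDl -mulrA; congr (_ + _).
  rewrite !mulrb; case: eqP => _; last by rewrite mul0r.
  apply: sum_s1_left; rewrite left_Fword mulrA s1_Fprod -mulrA subrK s1e eqxx //.
- by move=> w wL; rewrite left_Fword Fprod_long // mul0r.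
- move=> v <-; have [c ->] := left_span v; exists c.
  by apply: eq_bigr => w _; rewrite left_Fword.
- by move=> i v ve; rewrite -mulrA ve.
- by move=> mu v ve; rewrite -mulrA ve.
- by move=> v; rewrite -mulr_suml (wa_sum wa) mul1r.
- by move=> mu v; rewrite mulrA (wa_1M wa) eqxx.
- move=> w v wL; have -> : foldr (fun i u => sE i * u) v w = Eprod w * v.
    by elim: (w) => [|i u IH]; rewrite ?Eprod_nil ?mul1r // Eprod_cons -mulrA -IH.
  by rewrite Eprod_long // mul0r.
- move=> w; have -> : foldr (fun i u => sE i * u) x w = Eprod w * x.
    by elim: w => [|i u IH]; rewrite ?Eprod_nil ?mul1r // Eprod_cons -mulrA -IH.
  have xz : x * z = x by rewrite -xe -mulrA ez.
  by have := radx (Eprod w); rewrite /e -[s1 lam * z * _]mulrA -zC -!mulrA -[z * x]zC xz.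
Qed.

(** The mirror image: on e S right multiplication by F_i raises weights, and right
    multiplication by E_i lowers them. *)
Lemma right_nondeg x : e * x = x -> (forall y, x * y * e = 0) -> x = 0.
Proof.
move=> xe radx.
apply: (@pairing_radical_trivial _ _ _ spP _ _ _ _ A_diag rhov sp_q S
  (fun i u => u * sF i) (fun i u => u * sE i) (fun mu u => u * s1 mu) e lam Lb
  _ _ _ _ _ _ _ _ _ _ (fun v => e * v = v) wts) => //.
- by move=> i a u v; rewrite mulrDl -scalerAl.
- by move=> i a u v; rewrite mulrDl -scalerAl.
- by move=> i a u v; rewrite mulrDl -scalerAl.
- move=> mu i v; rewrite -!mulrA; congr (_ * _).
  by have := wa_F1 wa i (mu + simple_root A i); rewrite addrK.
- move=> mu i v; rewrite -!mulrA; congr (_ * _).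
  by have := wa_E1 wa i (mu - simple_root A i); rewrite subrK.
- exact: es1.
- exact: esF.
- move=> i j w; rewrite -mulrA (wa_EF wa) mulrDr mulrA; congr (_ + _).
  rewrite !mulrb eq_sym; case: eqP => [->|_]; last by rewrite mulr0.
  apply: sum_s1_right; rewrite right_Fword -mulrA.
  have := s1_Eprod lam (rev w); rewrite (_ : content A (rev w) = content A w) => [<-|].
    by rewrite mulrA es1 eqxx.
  by rewrite /content; apply: perm_big; rewrite perm_rev.
- by move=> w wL; rewrite right_Fword Eprod_long ?size_rev // mulr0.
- move=> v <-; have [c ->] := right_span v; exists c.
  by apply: eq_bigr => w _; rewrite right_Fword.
- by move=> i v ve; rewrite mulrA ve.
- by move=> mu v ve; rewrite mulrA ve.
- by move=> v; rewrite -mulr_sumr (wa_sum wa) mulr1.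
- by move=> mu v; rewrite -mulrA (wa_1M wa) eqxx.
- move=> w v wL; have -> : foldr (fun i u => u * sF i) v w = v * Fprod (rev w).
    elim: (w) => [|i u IH]; rewrite ?Fprod_nil ?mulr1 //= rev_cons -cats1.
    by rewrite /Fprod big_cat /= big_seq1 mulrA IH.
  by rewrite Fprod_long ?size_rev // mulr0.
- move=> w; have -> : foldr (fun i u => u * sF i) x w = x * Fprod (rev w).
    elim: w => [|i u IH]; rewrite ?Fprod_nil ?mulr1 //= rev_cons -cats1.
    by rewrite /Fprod big_cat /= big_seq1 mulrA IH.
  have xz : x * z = x by rewrite zC -xe mulrA -zC ez.
  by have := radx (Fprod (rev w)); rewrite /e mulrA zC !mulrA -[z * x]zC xz.
Qed.

Definition corner (x : S) : K := projT1 (cid (corner_scalar x)).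

Lemma cornerE x : e * x * e = corner x *: e.
Proof. by rewrite /corner; case: cid. Qed.

Lemma scale_e_inj a b : a *: e = b *: e -> a = b.
Proof.
move=> /eqP; rewrite -subr_eq0 -scalerBl scaler_eq0 (negPf e_neq0) orbF subr_eq0.
by move/eqP.
Qed.

Lemma corner_linear : linear (corner : S -> K^o).
Proof.
move=> a x y; apply: scale_e_inj; rewrite -cornerE mulrDr mulrDl -scalerAr -scalerAl.
by rewrite !cornerE scalerA -scalerDl.
Qed.

Lemma corner_neq0 x : e * x * e != 0 -> corner x != 0.
Proof. by rewrite cornerE scaler_eq0 negb_or => /andP []. Qed.

(** A nonzero a u v has a u <> 0, so by nondegeneracy some s satisfies
    e s a u in K^* e; then e s a u v is a nonzero multiple of v, so the ideal
    contains v and u v. *)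
Lemma principal_simple u v : u * e = u -> e * v = v -> u * v != 0 ->
  simple_left_ideal (principal (u * v)).
Proof.
move=> ue ev uv; split; first exact: principal_left_ideal.
  by exists (u * v) => //; apply/principalP; exists 1; rewrite mul1r.
move=> L' lL' sub [x xL x0] y /principalP [b ->].
have /principalP [a xE] := sub _ xL.
have [s es] : exists s, e * s * (a * u) != 0.
  have [//|h] := pselect (exists s, e * s * (a * u) != 0); case/negP: x0.
  rewrite xE mulrA (_ : a * u = 0) ?mul0r //.
  apply: left_nondeg => [|s]; first by rewrite -mulrA ue.
  by apply/eqP; apply: contra_notT h => nz; exists s.
rewrite mulrA; apply: left_idealMl => //.
have -> : v = ((corner (s * a * u))^-1%:A * (e * s)) * x.
  (* e s a u = corner (s a u) e recovers v from x = a u v. *)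
  have cn : corner (s * a * u) != 0.
    by apply: corner_neq0; move: es; rewrite -{1}ue !mulrA.
  rewrite xE -[_%:A * _]scalerAl mul1r -scalerAl.
  have -> : e * s * (a * (u * v)) = e * (s * a * u) * e * v.
    by move: ue; move: (e) => t ut; rewrite !mulrA -[t * s * a * u * t]mulrA ut.
  by rewrite cornerE -scalerAl ev scalerA mulVf // scale1r.
exact: left_idealMl.
Qed.

(** eps = sum_j q_j p_j for dual families of e S and S e acts as the identity on
    S e from the left and on e S from the right.  As x q_j lies in S e and p_j x
    in e S, both x eps and eps x equal eps x eps. *)
Lemma simple_block : exists eps : S, [/\ in_socle eps, eps * eps = eps,
  forall x, x * eps = eps * x, z * eps = eps & e * eps = e].
Proof.
pose P x := e * x = x; pose Q x := x * e = x.
have sP : subspace P.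
  by split=> [|a x y]; rewrite /P ?mulr0 // mulrDr -scalerAr => -> ->.
have sQ : subspace Q.
  by split=> [|a x y]; rewrite /Q ?mul0r // mulrDl -scalerAl => -> ->.
pose I : finType := Lb.-bseq 'I_n.
have reindexI (h : I -> S) (c : I -> K) :
    \sum_w c w *: h w = \sum_(j < #|I|) c (enum_val j) *: h (enum_val j).
  by rewrite (reindex _ (onW_bij _ (enum_val_bij I))).
pose g (j : 'I_#|I|) := e * Eprod (rev (enum_val j : I)).
pose h (j : 'I_#|I|) := Fprod (enum_val j : I) * e.
have spP' : spans P g.
  split=> [j|x Px]; first by rewrite /P /g mulrA ee.
  have [c cE] := right_span x; exists (fun j => c (enum_val j)).
  by rewrite -[LHS]Px cE reindexI.
have spQ' : spans Q h.
  split=> [j|x Qx]; first by rewrite /Q /h -mulrA ee.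
  have [c cE] := left_span x; exists (fun j => c (enum_val j)).
  by rewrite -[LHS]Qx cE reindexI.
pose beta (x y : S) := corner (x * y).
have bl y : linear (fun x => beta x y : K^o).
  by move=> a x x'; rewrite /beta mulrDl -scalerAl corner_linear.
have br y : linear (fun x => beta y x : K^o).
  by move=> a x x'; rewrite /beta mulrDr -scalerAr corner_linear.
have betaE x y : P x -> Q y -> x * y = beta x y *: e.
  by move=> Px Qy; rewrite -cornerE mulrA Px -mulrA Qy.
have [x Px hx|y Qy hy|p [Pp Qq pE qE]] := exists_dual_families bl br sP sQ spP' spQ'.
- apply: right_nondeg => // y; have := hx (y * e); rewrite /Q -mulrA ee => /(_ erefl) b0.
  by rewrite -mulrA betaE ?b0 ?scale0r // /Q -mulrA ee.
- apply: left_nondeg => // x; have := hy (e * x); rewrite /P mulrA ee => /(_ erefl) b0.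
  by rewrite betaE ?b0 ?scale0r // /P mulrA ee.
pose eps := \sum_j h j * p j.
have epsQ y : Q y -> eps * y = y.
  move=> Qy; rewrite {2}[y]qE // mulr_suml; apply: eq_bigr => j _.
  by rewrite -mulrA (betaE _ _ (Pp j) Qy) -scalerAr [h j * e]Qq.
have Peps x : P x -> x * eps = x.
  move=> Px; rewrite {2}[x]pE // mulr_sumr; apply: eq_bigr => j _.
  by rewrite mulrA (betaE _ _ Px (Qq j)) -scalerAl [e * p j]Pp.
have e1 x : eps * (x * eps) = x * eps.
  rewrite {2 3}/eps !mulr_sumr; apply: eq_bigr => j _.
  have xh : eps * (x * h j) = x * h j by apply: epsQ; rewrite /Q -mulrA [h j * e]Qq.
  by rewrite [x * (h j * p j)]mulrA [eps * _]mulrA xh.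
have e2 x : (eps * x) * eps = eps * x.
  rewrite {1 3}/eps !mulr_suml; apply: eq_bigr => j _.
  have px : (p j * x) * eps = p j * x by apply: Peps; rewrite /P mulrA [e * p j]Pp.
  by rewrite -[h j * p j * x]mulrA -[h j * _ * eps]mulrA px.
have epsC x : x * eps = eps * x by rewrite -[LHS]e1 mulrA e2.
exists eps; split=> //.
- rewrite /eps; apply: (big_ind (@in_socle S)); [exact: in_socle0|exact: in_socleD|].
  move=> j _; have [->|nz] := eqVneq (h j * p j) 0; first exact: in_socle0.
  exists [:: h j * p j]; rewrite big_seq1; split=> // y; rewrite inE => /eqP ->.
  by apply: principal_simple => //; [exact: Qq|exact: Pp].
- by rewrite -{2}[eps]mul1r e1 mul1r.
- rewrite mulr_sumr; apply: eq_bigr => j _; rewrite mulrA; congr (_ * _).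
  by rewrite -zC -[h j]Qq -mulrA ez.
- by apply: Peps; rewrite /P ee.
Qed.

End HighestIdempotent.

(** Induction on the number of weights that survive in the block of z: removing the
    simple block at a highest one leaves a smaller block. *)
Lemma central_idempotent_in_socle N (z : S) : z * z = z -> (forall x, x * z = z * x) ->
  (count (fun lam => (s1 lam * z != 0)%R) wts <= N)%N -> in_socle z.
Proof.
elim: N z => [|N IH] z zz zC.
  rewrite leqn0 -[_ == _]negbK -lt0n -has_count => /hasPn h.
  rewrite -[z]mul1r -(wa_sum wa) mulr_suml big_seq big1; first exact: in_socle0.
  by move=> lam /h; rewrite negbK => /eqP.
move=> cN.
have [hz|/hasPn h] := boolP (has (fun lam => s1 lam * z != 0) wts); last first.
  rewrite -[z]mul1r -(wa_sum wa) mulr_suml big_seq big1; first exact: in_socle0.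
  by move=> lam /h; rewrite negbK => /eqP.
pose f := fun lam => s1 lam * z != 0.
have [lam0 lam0f] : exists lam0, lam0 \in filter f wts.
  by move/hasP: hz => [lam0 lw lz]; exists lam0; rewrite mem_filter /f lz.
(* Maximal height makes lam + alpha_i vanish in the block of z. *)
have [lam] := seq_has_max (height r) lam0f; rewrite mem_filter => /andP [lz lw] lmax.
have z_max i : s1 (lam + simple_root A i) * z = 0.
  apply/eqP; apply: contraT => nz.
  have [iw|/(wa_out wa) e0] := boolP (lam + simple_root A i \in wts); last first.
    by rewrite e0 mul0r eqxx in nz.
  have := lmax (lam + simple_root A i); rewrite mem_filter /f nz iw => /(_ isT).
  rewrite heightD height_root // gerDl => h10.
  by have := lt_le_trans (ltr01 : 0 < 1 :> k) h10; rewrite ltxx.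
have [eps [soc epseps epsC zeps eeps]] := simple_block zz zC z_max lz.
have epsz : eps * z = eps by rewrite -epsC.
rewrite -[z](subrK eps); apply: in_socleD => //; apply: IH.
- by rewrite mulrBr !mulrBl zz epsz zeps epseps subrr subr0.
- by move=> x; rewrite mulrBr mulrBl zC epsC.
have dec mu : s1 mu * (z - eps) != 0 -> f mu && (mu != lam).
  rewrite mulrBr => nz; apply/andP; split.
    apply: contra nz => /eqP e0; rewrite -zeps mulrA e0 mul0r subrr //.
  apply: contra nz => /eqP ->; rewrite -{1}eeps -mulrA zeps subrr //.
apply: leq_trans (_ : count (fun mu => f mu && (mu != lam)) wts <= N)%N.
  exact: sub_count.
rewrite -ltnS; apply: leq_trans cN.
have : (count (fun mu => f mu && (mu != lam)) wts + count (pred1 lam) wts <= count f wts)%N.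
  rewrite -count_predUI [X in (_ + X)%N](_ : _ = 0%N); last first.
    rewrite -[RHS](count_pred0 wts); apply: eq_count => mu /=.
    by case: eqP; rewrite ?andbF.
  rewrite addn0; apply: sub_count => mu /=; case/orP => [/andP [] //|/eqP ->].
  exact: lz.
by rewrite count_uniq_mem // lw addn1.
Qed.

Theorem weight_algebra_semisimple : semisimple_ring S.
Proof.
apply: semisimple_of_socle; apply: central_idempotent_in_socle (leqnn _).
  exact: mulr1.
by move=> x; rewrite mulr1 mul1r.
Qed.

End WeightAlgebra.

Section Salg.
Variables (n : nat) (A : 'M[int]_n) (d : 'I_n -> nat) (pi : set (weight n)).
Hypothesis hA : cartan_matrix_of_finite_type A d.
Hypothesis hfin : finite_set pi.

Let S := Salg A d pi.
Let Wpi := weyl_orbits A pi.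
Let alpha := simple_root A.

Lemma orbits_finite : finite_set Wpi.
Proof. exact: (weyl_orbits_finite hA hfin). Qed.

(** * The generalized Schur algebra *)

Definition orbit_weights : seq (weight n) := fset_set Wpi.

Lemma orbit_weightsP lam : reflect (Wpi lam) (lam \in orbit_weights).
Proof. by apply: (iffP idP); rewrite in_fset_set ?inE //; exact: orbits_finite. Qed.

Definition Salg_pi (x : Sfree A pi) : S := presalg_pi (@Srel n A d pi) x.
Definition Salg_E i : S := Salg_pi (genE A pi i).
Definition Salg_F i : S := Salg_pi (genF A pi i).
Definition Salg_1 lam : S := Salg_pi (gen1 A pi lam).

Lemma Salg_piM x y : Salg_pi (x * y) = Salg_pi x * Salg_pi y. Proof. exact:
  presalg_piM. Qed.
Lemma Salg_piB x y : Salg_pi (x - y) = Salg_pi x - Salg_pi y. Proof. exact: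
  presalg_piB. Qed.
Lemma Salg_piD x y : Salg_pi (x + y) = Salg_pi x + Salg_pi y. Proof. exact:
  presalg_piD. Qed.
Lemma Salg_piZ c x : Salg_pi (c *: x) = c *: Salg_pi x. Proof. exact: presalg_piZ. Qed.
Lemma Salg_pi0 : Salg_pi 0 = 0.
Proof. by rewrite -(subrr 0) Salg_piB subrr. Qed.
Lemma Salg_pi_sum (I : Type) (r : seq I) (F : I -> Sfree A pi) :
  Salg_pi (\sum_(i <- r) F i) = \sum_(i <- r) Salg_pi (F i).
Proof. by apply: (big_morph Salg_pi Salg_piD Salg_pi0). Qed.

Lemma Salg_pi_rel x y : @Srel n A d pi x y -> Salg_pi x = Salg_pi y.
Proof. by move=> h; apply/eqP/presalg_eqP; apply: RelidealRel. Qed.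

Lemma Salg_scalerAl (k : Qv) (x y : S) : k *: (x * y) = (k *: x) * y.
Proof. exact: presalg_scalerAl. Qed.
Lemma Salg_scalerAr (k : Qv) (x y : S) : k *: (x * y) = x * (k *: y).
Proof. exact: presalg_scalerAr. Qed.

Lemma Salg_1_out lam : ~ Wpi lam -> Salg_1 lam = 0.
Proof.
move=> nW; rewrite /Salg_1 /gen1; case: insubP => [u|_]; last exact: Salg_pi0.
by rewrite inE.
Qed.

Lemma Salg_1M lam mu : Salg_1 lam * Salg_1 mu = Salg_1 lam *+ (lam == mu).
Proof.
have [Wl|/Salg_1_out ->] := pselect (Wpi lam); last by rewrite mul0r mul0rn.
have [Wm|nW] := pselect (Wpi mu).
  rewrite -Salg_piM (Salg_pi_rel (Srel_idem d Wl Wm)); case: eqP => _ //.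
  exact: Salg_pi0.
rewrite (Salg_1_out nW) mulr0; case: eqP => [e|_]; last by rewrite mulr0n.
by case: nW; rewrite -e.
Qed.

Lemma Salg_1_sum : \sum_(lam <- orbit_weights) Salg_1 lam = 1.
Proof.
by rewrite -Salg_pi_sum -(fsbig_finite _ _ orbits_finite) /= (Salg_pi_rel (Srel_unit A
  d pi)).
Qed.

Lemma Salg_E1 i lam : Salg_E i * Salg_1 lam = Salg_1 (lam + alpha i) * Salg_E i.
Proof.
have [Wl|nW] := pselect (Wpi lam);
  first by rewrite -Salg_piM (Salg_pi_rel (Srel_E1 d i Wl)) Salg_piM.
rewrite (Salg_1_out nW) mulr0.
have [Wl|nW'] := pselect (Wpi (lam + alpha i)); last by rewrite (Salg_1_out nW') mul0r.
by rewrite -Salg_piM (Salg_pi_rel (Srel_1E d i Wl)) Salg_piM addrK -/(Salg_1 _)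
  (Salg_1_out nW) mulr0.
Qed.

Lemma Salg_F1 i lam : Salg_F i * Salg_1 lam = Salg_1 (lam - alpha i) * Salg_F i.
Proof.
have [Wl|nW] := pselect (Wpi lam);
  first by rewrite -Salg_piM (Salg_pi_rel (Srel_F1 d i Wl)) Salg_piM.
rewrite (Salg_1_out nW) mulr0.
have [Wl|nW'] := pselect (Wpi (lam - alpha i)); last by rewrite (Salg_1_out nW') mul0r.
by rewrite -Salg_piM (Salg_pi_rel (Srel_1F d i Wl)) Salg_piM subrK -/(Salg_1 _)
  (Salg_1_out nW) mulr0.
Qed.

Lemma Salg_EF i j : Salg_E i * Salg_F j = Salg_F j * Salg_E i +
  (\sum_(lam <- orbit_weights) qint (d i) (pairing i lam) *: Salg_1 lam) *+ (i == j).
Proof.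
apply/eqP; rewrite addrC -subr_eq -!Salg_piM -Salg_piB (Salg_pi_rel (Srel_EF A d pi i j)).
rewrite (fsbig_finite _ _ orbits_finite) !mulrb; case: (i =P j) => _;
  last by rewrite Salg_pi0.
by rewrite Salg_pi_sum; apply/eqP; apply: eq_bigr => lam _; apply: Salg_piZ.
Qed.

(** S(pi) is generated by the E_i, the F_i and the idempotents. *)
Lemma Salg_ind (P : S -> Prop) : subspace P -> P 1 ->
  (forall i x, P x -> P (Salg_E i * x)) -> (forall i x, P x -> P (Salg_F i * x)) ->
  (forall lam x, P x -> P (Salg_1 lam * x)) -> forall x, P x.
Proof.
move=> sP P1 PE PF P1l x; rewrite -[x]presalg_piK -/(Salg_pi _); move: (repr x).
apply: freealg_ind => [|a y z Py Pz||g y Py].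
- by rewrite Salg_pi0; apply: subspace0.
- by rewrite Salg_piD Salg_piZ; apply: sP.2.
- exact: P1.
- rewrite Salg_piM; case: g => [[i|i]|l]; [exact: PE|exact: PF|].
  suff -> : Salg_pi (freegen Qv (inr l : Sgen A pi)) = Salg_1 (val l) by apply: P1l.
  by rewrite /Salg_1 /gen1 valK.
Qed.

End Salg.

Section Final.
Variables (n : nat) (A : 'M[int]_n) (d : 'I_n -> nat) (pi : set (weight n)).
Hypothesis hA : cartan_matrix_of_finite_type A d.
Hypothesis hfin : finite_set pi.

Let S := Salg A d pi.

Lemma Salg_trivial : (1 : S) = 0 -> finite_dimensional S /\ semisimple_ring S.
Proof.
move=> S10; have S0 (x : S) : x = 0 by rewrite -[x]mul1r S10 mul0r.
split.
  apply: (@finite_dimensional_spanned _ _ 0 (fun=> 0)) => x.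
  by exists (fun=> 0); rewrite big_ord0; apply: S0.
exists 0%N, (fun=> (fun=> false) : {pred S^o}); split=> [[]//|x].
exists [ffun=> 0]; split=> [|u _]; last by apply/ffunP => -[].
by split=> [[]//|]; rewrite big_ord0; apply: S0.
Qed.

(** The proof that 1 <> 0 is carried by the type, on which the structure of a
    nonzero algebra can thus be declared. *)
Definition nzSalg of (1 : S) != 0 : Type := S.

Section Nontrivial.
Hypothesis S10 : (1 : S) != 0.

HB.instance Definition _ := GRing.PzRing.on (nzSalg S10).
HB.instance Definition _ := GRing.Lmodule.on (nzSalg S10).
HB.instance Definition _ := GRing.PzSemiRing_isNonZero.Build (nzSalg S10) S10.
HB.instance Definition _ := GRing.Lmodule_isLalgebra.Build Qv (nzSalg S10)
  (@Salg_scalerAl n A d pi).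
HB.instance Definition _ := GRing.Lalgebra_isAlgebra.Build Qv (nzSalg S10)
  (@Salg_scalerAr n A d pi).

End Nontrivial.

Lemma Salg_weight_algebra (S10 : (1 : S) != 0) :
  @weight_algebra Qv (nzSalg S10) n A (fun i => qint (d i)) (orbit_weights A pi)
    (Salg_E A d pi) (Salg_F A d pi) (Salg_1 A d pi).
Proof.
split.
- by move=> lam /(orbit_weightsP hA hfin); apply: Salg_1_out.
- exact: Salg_1M.
- exact: Salg_1_sum hA hfin.
- exact: Salg_E1.
- exact: Salg_F1.
- exact: Salg_EF hA hfin.
- exact: Salg_ind.
Qed.

Lemma Salg_nontrivial : (1 : S) != 0 -> finite_dimensional S /\ semisimple_ring S.
Proof.
move=> S10; have wa := Salg_weight_algebra S10.
have [r rhov] := exists_rho_check hA.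
have [Aii _ dpos _ _] := hA.
have [B hB] : exists B : nat, forall lam, lam \in orbit_weights A pi -> `|height r lam|
  <= B%:R.
  pose s := \sum_(lam <- orbit_weights A pi) `|height r lam|.
  exists (Num.bound s) => lam lw; apply: ltW; apply: le_lt_trans (archi_boundP _).
    by rewrite /s (big_rem lam) //= lerDl sumr_ge0.
  exact: sumr_ge0.
have height_gap lam mu : lam \in orbit_weights A pi -> mu \in orbit_weights A pi ->
    height r lam - height r mu <= (B + B)%:R.
  move=> /hB h1 /hB h2; apply: le_trans (ler_norm _) _; apply: le_trans (ler_normB _ _) _.
  by rewrite natrD lerD.
split; first exact: (weight_algebra_finite_dimensional rhov wa height_gap).
apply: (weight_algebra_semisimple value_at1_place _ Aii rhov wa _ height_gap).
- by move=> i c; apply: value_at1_qint; case/andP: (dpos i).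
- exact: finmap.fset_uniq.
Qed.

End Final.

Theorem proposition3p8 (n : nat) (A : 'M[int]_n) (d : 'I_n -> nat)
    (pi : set (weight n))
    (hA : cartan_matrix_of_finite_type A d)
    (hfin : finite_set pi)
    (hsat : saturated A pi) :
  finite_dimensional (Salg A d pi) /\ semisimple_ring (Salg A d pi).
Proof.
by have [/Salg_trivial|/(Salg_nontrivial hA hfin)] := eqVneq (1 : Salg A d pi) 0.
Qed.
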